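(* Let $n\geqslant 1$ be an integer, let $c,H>0$ and let $b,m^2\geqslant 0$ be such that $b^2\geqslant 4m^2$. Let $\beta\geqslant 0$, $p>1$ and set $$r_{\mathrm{crit}}(b,m^2,\beta,p)=\tfrac12\left(b-\sqrt{b^2-4m^2}\right)\left((\beta+1)p-1\right),\qquad \kappa_{\mathrm{crit}}(b,m^2,\beta,p)=\begin{cases}-1 & \text{if } b^2>4m^2,\\ -1-(\beta+1)p & \text{if } b^2=4m^2.\end{cases}$$ Assume $\kappa>\kappa_{\mathrm{crit}}(b,m^2,\beta,p)$ and consider $\Gamma(t)=\mu\,\mathrm{e}^{r_{\mathrm{crit}}(b,m^2,\beta,p)t}(1+t)^{\kappa}$ for some $\mu>0$ in the nonlinear term $$f(t,u)=\Gamma(t)\left(\int_{\mathbb{R}^n}|u(t,y)|^p\,\mathrm{d}y\right)^{\beta}|u|^p .$$ Let $u_0,u_1\in L^1_{\mathrm{loc}}(\mathbb{R}^n)$ be nonnegative, nontrivial and compactly supported functions with supports contained in $B_R$ for some $R>0$. Let $u\in\mathcal{C}^1([0,T),L^1_{\mathrm{loc}}(\mathbb{R}^n))$ be a weak solution (in the sense defined in the context) to the Cauchy problem $$\begin{cases}\partial_t^2u-c^2\mathrm{e}^{-2Ht}\Delta u+b\,\partial_tu+m^2u=f(t,u), & x\in\mathbb{R}^n,\ t\in(0,T),\\ u(0,x)=\varepsilon u_0(x), & x\in\mathbb{R}^n,\\ \partial_tu(0,x)=\varepsilon u_1(x), & x\in\mathbb{R}^n,\end{cases}$$ with lifespan $T=T(\varepsilon)$.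 Then there exists a positive constant $\varepsilon_0=\varepsilon_0(n,c,H,b,m^2,\beta,p,\mu,\kappa,u_0,u_1,R)$ such that for any $\varepsilon\in(0,\varepsilon_0]$ the weak solution $u$ blows up in finite time. Furthermore, the following upper bound estimates for the lifespan hold: $$T(\varepsilon)\leqslant\begin{cases}C\,\varepsilon^{-\frac{(\beta+1)p-1}{\kappa+1}} & \text{if } b^2>4m^2,\\[4pt] C\,\varepsilon^{-\left(\frac{\kappa+2}{(\beta+1)p-1}+1\right)^{-1}} & \text{if } b^2=4m^2,\end{cases}$$ where the positive constant $C$ is independent of $\varepsilon$.
   Context: Here $\varepsilon>0$ is a parameter describing the size of the initial data, $B_\rho=\{x\in\mathbb{R}^n:|x|\leqslant\rho\}$, and $T=T(\varepsilon)\in(0,\infty]$ denotes the lifespan, i.e. the maximal existence time, of the weak solution; blow-up in finite time means $T(\varepsilon)<\infty$. Set $A_{\mathrm{dS}}(t)=\int_0^t c\,\mathrm{e}^{-H\tau}\,\mathrm{d}\tau=\frac{c}{H}(1-\mathrm{e}^{-Ht})$. Definition (weak solution). Let $u_0,u_1\in L^1_{\mathrm{loc}}(\mathbb{R}^n)$ with $\operatorname{supp}u_0,\operatorname{supp}u_1\subset B_R$ for some $R>0$. A function $u\in\mathcal{C}^1([0,T),L^1_{\mathrm{loc}}(\mathbb{R}^n))$ such that $f(t,u)\in L^1_{\mathrm{loc}}((0,T)\times\mathbb{R}^n)$ is a weak solution to the Cauchy problem on $[0,T)$ if $\operatorname{supp}u(t,\cdot)\subset B_{R+A_{\mathrm{dS}}(t)}$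 for any $t\in(0,T)$ and the integral identity $$\begin{aligned}&\int_{\mathbb{R}^n}\partial_tu(t,x)\varphi(t,x)\,\mathrm{d}x-\int_{\mathbb{R}^n}u(t,x)\varphi_t(t,x)\,\mathrm{d}x+b\int_{\mathbb{R}^n}u(t,x)\varphi(t,x)\,\mathrm{d}x\\&\quad+\int_0^t\int_{\mathbb{R}^n}u(s,x)\left(\varphi_{ss}(s,x)-c^2\mathrm{e}^{-2Hs}\Delta\varphi(s,x)-b\,\varphi_s(s,x)+m^2\varphi(s,x)\right)\mathrm{d}x\,\mathrm{d}s\\&=\varepsilon\int_{\mathbb{R}^n}u_1(x)\varphi(0,x)\,\mathrm{d}x+\varepsilon\int_{\mathbb{R}^n}u_0(x)\left(b\,\varphi(0,x)-\varphi_t(0,x)\right)\mathrm{d}x\\&\quad+\int_0^t\Gamma(s)\left(\int_{\mathbb{R}^n}|u(s,y)|^p\,\mathrm{d}y\right)^{\beta}\int_{\mathbb{R}^n}|u(s,x)|^p\varphi(s,x)\,\mathrm{d}x\,\mathrm{d}s\end{aligned}$$ holds for any $t\in(0,T)$ and any test function $\varphi\in\mathcal{C}^\infty_0([0,T)\times\mathbb{R}^n)$. *)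

(* Defs.v *)
From HB Require Import structures.
From mathcomp Require Import all_boot all_order all_algebra.
From mathcomp Require Import all_classical all_reals all_analysis.
From mathcomp Require Import measurable_realfun.

Set Implicit Arguments.
Unset Strict Implicit.
Unset Printing Implicit Defensive.

Import Order.TTheory GRing.Theory Num.Theory.
Import numFieldNormedType.Exports.

Local Open Scope classical_set_scope.
Local Open Scope ring_scope.

(* R^n is 'rV[R]_n, with its canonical topology.  Its Borel sigma-algebra is
   presented, as for n.-tuple, as the one generated by the coordinates. *)
Definition rV_display : measure_display -> measure_display.
Proof. exact. Qed.

Section measurable_rV.
Variables (R : realType) (n : nat).

Let coors : 'I_n -> 'rV[R]_n -> R := fun i x => x ord0 i.

Let rV_set0 : g_sigma_preimage coors set0.
Proof. exact: sigma_algebra0. Qed.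

Let rV_setC A : g_sigma_preimage coors A -> g_sigma_preimage coors (~` A).
Proof. exact: sigma_algebraC. Qed.

Let rV_bigcup (F : _^nat) : (forall i, g_sigma_preimage coors (F i)) ->
  g_sigma_preimage coors (\bigcup_i (F i)).
Proof. exact: sigma_algebra_bigcup. Qed.

HB.instance Definition _ := @isMeasurable.Build (rV_display default_measure_display)
  'rV[R]_n (g_sigma_preimage coors) rV_set0 rV_setC rV_bigcup.

End measurable_rV.

Section lebesgue_rV.
Variable R : realType.

Lemma measurable_coord n (i : 'I_n) :
  measurable_fun [set: 'rV[R]_n] (fun x : 'rV[R]_n => x ord0 i).
Proof.
move=> _ Y mY; rewrite setTI; apply: sub_sigma_algebra => /=.
rewrite -bigcup_seq/=; exists i => /=; first by rewrite mem_index_enum.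
by exists Y => //; rewrite setTI.
Qed.

Definition cons_rV n (p : R * 'rV[R]_n) : 'rV[R]_n.+1 :=
  \row_i oapp (p.2 ord0) p.1 (unlift ord0 i).

Lemma measurable_cons_rV n : measurable_fun [set: R * 'rV[R]_n] (@cons_rV n).
Proof.
move=> _ A mA; rewrite setTI.
suff: @measurable _ 'rV[R]_n.+1 `<=`
    [set B | measurable (@cons_rV n @^-1` B)] by exact.
apply: smallest_sub.
  split => /=.
  - by rewrite preimage_set0; exact: measurable0.
  - by move=> B mB; rewrite setTD preimage_setC; exact: measurableC.
  - by move=> F mF; rewrite preimage_bigcup; exact: bigcupT_measurable.
rewrite -bigcup_seq/=; apply: bigcup_sub => i _ _ [B mB <-] /=.
rewrite setTI -comp_preimage -[X in measurable X]setTI.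
have [j ->|->] := unliftP ord0 i.
  rewrite [X in X @^-1` _](_ : _ = (fun x : 'rV[R]_n => x ord0 j) \o snd); last first.
    by apply/funext => p /=; rewrite mxE liftK.
  by apply: (measurableT_comp (measurable_coord j) measurable_snd).
rewrite [X in X @^-1` _](_ : _ = fst); last first.
  by apply/funext => p /=; rewrite mxE unlift_none.
exact: measurable_fst.
Qed.

Section leb_succ.
Variables (n : nat) (m : {sigma_finite_measure set 'rV[R]_n -> \bar R}).

Definition leb_succ : set 'rV[R]_n.+1 -> \bar R :=
  pushforward (@lebesgue_measure R \x m)%E (@cons_rV n).

Let leb_succ0 : leb_succ set0 = 0%E.
Proof. by rewrite /leb_succ /pushforward preimage_set0 measure0. Qed.

Let leb_succ_ge0 A : (0 <= leb_succ A)%E.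
Proof. by rewrite /leb_succ /pushforward measure_ge0. Qed.

Let leb_succ_sigma_additive : semi_sigma_additive leb_succ.
Proof.
have mf := @measurable_cons_rV n.
move=> F mF tF mUF; rewrite /leb_succ /pushforward preimage_bigcup.
apply: measure_semi_sigma_additive.
- by move=> k; rewrite -[X in measurable X]setTI; exact: mf.
- apply/trivIsetP => /= i j _ _ ij; rewrite -preimage_setI.
  by move/trivIsetP : tF => /(_ _ _ _ _ ij) ->//; rewrite preimage_set0.
- by rewrite -preimage_bigcup -[X in measurable X]setTI; exact: mf.
Qed.

HB.instance Definition _ := isMeasure.Build _ _ _ leb_succ
  leb_succ0 leb_succ_ge0 leb_succ_sigma_additive.

Let leb_succ_sigma_finite : sigma_finite setT leb_succ.
Proof.
have [F TF Foo] := sigma_finiteT (@lebesgue_measure R).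
have [G TG Goo] := sigma_finiteT m.
pose hd (x : 'rV[R]_n.+1) := x ord0 ord0.
pose tl (x : 'rV[R]_n.+1) : 'rV[R]_n := \row_j x ord0 (lift ord0 j).
have mhd : measurable_fun setT hd by exact: measurable_coord.
have mtl : measurable_fun setT tl.
  move=> _ A mA; rewrite setTI.
  suff: @measurable _ 'rV[R]_n `<=` [set B | measurable (tl @^-1` B)] by exact.
  apply: smallest_sub.
    split => /=.
    - by rewrite preimage_set0; exact: measurable0.
    - by move=> B mB; rewrite setTD preimage_setC; exact: measurableC.
    - by move=> K mK; rewrite preimage_bigcup; exact: bigcupT_measurable.
  rewrite -bigcup_seq/=; apply: bigcup_sub => i _ _ [B mB <-] /=.
  rewrite setTI -comp_preimage -[X in measurable X]setTI.
  rewrite [X in X @^-1` _](_ : _ = fun x : 'rV[R]_n.+1 => x ord0 (lift ord0 i)).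
    exact: measurable_coord.
  by apply/funext => p /=; rewrite mxE.
have hdK p : hd (@cons_rV n p) = p.1 by rewrite /hd mxE unlift_none.
have tlK p : tl (@cons_rV n p) = p.2.
  by apply/rowP => j; rewrite !mxE liftK.
pose D (k : nat * nat) := hd @^-1` F k.1 `&` tl @^-1` G k.2.
pose E k := if @unpickle (nat * nat)%type k is Some p then D p else set0.
exists E.
  apply/esym; rewrite -subTset => x _.
  have [i _ Fi] : (\bigcup_i F i) (hd x) by rewrite -TF.
  have [j _ Gj] : (\bigcup_i G i) (tl x) by rewrite -TG.
  by exists (pickle (i, j)) => //; rewrite /E pickleK.
move=> k; rewrite /E; case: unpickle => [[i j]|]; last first.
  by split => //; rewrite measure0.
have [mF Fi] := Foo i; have [mG Gj] := Goo j.
split.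
  by apply: measurableI; rewrite -[X in measurable X]setTI; [exact: mhd|exact: mtl].
rewrite /= /leb_succ /pushforward.
rewrite [X in ((_ \x _) X)%E](_ : _ = F i `*` G j).
  by rewrite product_measure1E// lte_mul_pinfty// ge0_fin_numE.
by apply/seteqP; split => p /=; rewrite /D /= hdK tlK.
Qed.

HB.instance Definition _ := Measure_isSigmaFinite.Build _ _ _ leb_succ
  leb_succ_sigma_finite.

End leb_succ.

(* Lebesgue measure on R^n: the n-fold product of the one-dimensional one. *)
Fixpoint leb n : {sigma_finite_measure set 'rV[R]_n -> \bar R} :=
  if n is n'.+1 then leb_succ (leb n') else @dirac _ 'rV[R]_0 0 R.

Lemma leb_box n (A : 'I_n -> set R) : (forall i, measurable (A i)) ->
  leb n [set x | forall i, A i (x ord0 i)] =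
  (\prod_(i < n) @lebesgue_measure R (A i))%E.
Proof.
elim: n A => [|n IH] A mA.
  rewrite big_ord0 /= diracE mem_set//=.
  by case.
set B := [set x : 'rV[R]_n | forall i, A (lift ord0 i) (x ord0 i)].
have mB : measurable B.
  rewrite (_ : B = \big[setI/setT]_(i < n)
      (fun x : 'rV[R]_n => x ord0 i) @^-1` A (lift ord0 i)).
    apply: bigsetI_measurable => i _.
    by rewrite -[X in measurable X]setTI; exact: measurable_coord.
  rewrite -bigcap_seq; apply/seteqP; split => x /= Ax i.
    by move=> _; exact: Ax.
  by apply: (Ax i); rewrite /= mem_index_enum.
rewrite big_ord_recl -(IH (fun i => A (lift ord0 i)))// -/B.
rewrite -product_measure1E//=; last exact: mA.
rewrite /leb_succ /pushforward.
congr ((_ \x _)%E _); apply/seteqP; split => p /=.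
  move=> Ap; split; first by have := Ap ord0; rewrite mxE unlift_none.
  by move=> i; have := Ap (lift ord0 i); rewrite mxE liftK.
move=> [A0 A1] i; rewrite mxE.
by have [j ->|->] := unliftP ord0 i; [exact: A1|exact: A0].
Qed.

End lebesgue_rV.

Section function_spaces.
Variables (R : realType) (n : nat).
Local Notation space := 'rV[R]_n.

(* The canonical norm on 'rV[R]_n is the sup norm. *)
Definition enorm (x : space) : R := Num.sqrt (\sum_i x ord0 i ^+ 2).

Definition eball (r : R) : set space := [set x | enorm x <= r].

Definition ess_supp (f : space -> R) : set space :=
  ~` \bigcup_(O in [set O : set space |
       open O /\ {ae leb R n, forall x, O x -> f x = 0}]) O.

Definition L1loc (f : space -> R) : Prop :=
  measurable_fun setT f /\
  forall K, compact K -> (\int[leb R n]_(x in K) `|f x|%:E < +oo)%E.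

(* T = +oo is allowed. *)
Definition time_dom (T : \bar R) : set R := [set t | 0 <= t /\ (t%:E < T)%E].

Definition slab (T : \bar R) : set (R * space) :=
  [set z | 0 < z.1 /\ (z.1%:E < T)%E].

Definition L1loc_slab (T : \bar R) (g : R * space -> \bar R) : Prop :=
  measurable_fun (slab T) g /\
  forall K, K `<=` slab T -> compact K ->
    (\int[@lebesgue_measure R \x leb R n]_(z in K) `|g z| < +oo)%E.

(* C([0,T), L^1_loc(R^n)) and C^1([0,T), L^1_loc(R^n)), where L^1_loc carries
   the topology of the seminorms of L^1(K), K compact. Limits are taken
   within [0,T), hence are one-sided at 0. *)
Definition C0_L1loc (T : \bar R) (u : R -> space -> R) : Prop :=
  forall t, time_dom T t -> L1loc (u t) /\
    forall K, compact K ->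
      (\int[leb R n]_(x in K) `|u s x - u t x|%:E)%E
        @[s --> within (time_dom T) (nbhs t)] --> 0%E.

Definition is_time_derivative (T : \bar R) (u ut : R -> space -> R) : Prop :=
  forall t, time_dom T t -> forall K, compact K ->
    (\int[leb R n]_(x in K) `|(u s x - u t x) / (s - t) - ut t x|%:E)%E
      @[s --> within (time_dom T) t^'] --> 0%E.

Definition C1_L1loc (T : \bar R) (u ut : R -> space -> R) : Prop :=
  [/\ C0_L1loc T u, C0_L1loc T ut & is_time_derivative T u ut].

End function_spaces.

Fixpoint is_Ck (R : realType) (V : normedModType R) (k : nat) (f : V -> R)
    : Prop :=
  if k is k'.+1 then
    [/\ continuous f, forall x v, derivable f x v &
        forall v, is_Ck k' (fun x => 'D_v f x)]
  else continuous f.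

Definition smooth (R : realType) (V : normedModType R) (f : V -> R) : Prop :=
  forall k, is_Ck k f.

Section test_functions.
Variables (R : realType) (n : nat).
Implicit Types phi : R * 'rV[R]_n -> R.

(* As usual for a domain with boundary, an element of C_0^oo([0,T) x R^n) is
   represented by a function that is smooth across the boundary t = 0: phi is
   an element of C_0^oo((-oo,T) x R^n), of which only the restriction to
   nonnegative times is used below.  In particular, phi need not vanish at
   t = 0. *)
Definition test_function (T : \bar R) phi : Prop :=
  [/\ smooth phi, compact (closure [set z | phi z != 0]) &
      forall z, closure [set z | phi z != 0] z -> (z.1%:E < T)%E].

Definition dt phi : R * 'rV[R]_n -> R := 'D_(1, 0) phi.

Definition dx (i : 'I_n) phi : R * 'rV[R]_n -> R :=
  'D_(0, delta_mx ord0 i) phi.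

Definition laplacian phi : R * 'rV[R]_n -> R :=
  fun z => \sum_(i < n) dx i (dx i phi) z.

End test_functions.

Section cauchy_problem.
Variables (R : realType) (n : nat).

Definition A_dS (c H t : R) : R := c / H * (1 - expR (- (H * t))).

Definition Lp_mass (p : R) (v : 'rV[R]_n -> R) : \bar R :=
  (\int[leb R n]_y (`|v y| `^ p)%:E)%E.

(* Extended-real valued: it is the local integrability required of weak
   solutions that makes it finite almost everywhere.  x `^ 0 = 1 for all x,
   +oo included, so that beta = 0 gives the local nonlinearity. *)
Definition nonlinearity (Gamma : R -> R) (beta p : R) (u : R -> 'rV[R]_n -> R)
    : R * 'rV[R]_n -> \bar R :=
  fun z => ((Gamma z.1)%:E * Lp_mass p (u z.1) `^ beta
            * (`|u z.1 z.2| `^ p)%:E)%E.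

Definition weak_identity (c H b m2 beta p : R) (Gamma : R -> R) (eps : R)
    (u0 u1 : 'rV[R]_n -> R) (u ut : R -> 'rV[R]_n -> R) (t : R)
    (phi : R * 'rV[R]_n -> R) : Prop :=
  ((\int[leb R n]_x (ut t x * phi (t, x))%:E)
   - (\int[leb R n]_x (u t x * dt phi (t, x))%:E)
   + b%:E * (\int[leb R n]_x (u t x * phi (t, x))%:E)
   + (\int[@lebesgue_measure R]_(s in `[0%R, t]) \int[leb R n]_x
        (u s x * (dt (dt phi) (s, x)
                  - c ^+ 2 * expR (- (2 * H * s)) * laplacian phi (s, x)
                  - b * dt phi (s, x) + m2 * phi (s, x)))%:E)
   = eps%:E * (\int[leb R n]_x (u1 x * phi (0%R, x))%:E)
     + eps%:E * (\int[leb R n]_x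
         (u0 x * (b * phi (0%R, x) - dt phi (0%R, x)))%:E)
     + (\int[@lebesgue_measure R]_(s in `[0%R, t])
         ((Gamma s)%:E * Lp_mass p (u s) `^ beta
          * \int[leb R n]_x (`|u s x| `^ p * phi (s, x))%:E)))%E.

(* The witness ut represents the class of the time derivative of u. *)
Definition weak_solution (c H b m2 beta p : R) (Gamma : R -> R) (eps r : R)
    (u0 u1 : 'rV[R]_n -> R) (T : \bar R) (u : R -> 'rV[R]_n -> R) : Prop :=
  exists2 ut, C1_L1loc T u ut &
  [/\ L1loc_slab T (nonlinearity Gamma beta p u),
      forall t, 0 < t -> (t%:E < T)%E ->
        ess_supp (u t) `<=` eball (r + A_dS c H t) &
      forall t phi, 0 < t -> (t%:E < T)%E -> test_function T phi ->
        weak_identity c H b m2 beta p Gamma eps u0 u1 u ut t phi].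

(* Maximality of the existence time; extensions agree with u almost everywhere
   in space, at each time. *)
Definition has_lifespan (c H b m2 beta p : R) (Gamma : R -> R) (eps r : R)
    (u0 u1 : 'rV[R]_n -> R) (T : \bar R) (u : R -> 'rV[R]_n -> R) : Prop :=
  weak_solution c H b m2 beta p Gamma eps r u0 u1 T u /\
  forall (T' : \bar R) (v : R -> 'rV[R]_n -> R), (T < T')%E ->
    weak_solution c H b m2 beta p Gamma eps r u0 u1 T' v ->
    ~ (forall t, time_dom T t -> {ae leb R n, forall x, v t x = u t x}).

End cauchy_problem.

Definition r_crit (R : realType) (b m2 beta p : R) : R :=
  2^-1 * (b - Num.sqrt (b ^+ 2 - 4 * m2)) * ((beta + 1) * p - 1).

Definition kappa_crit (R : realType) (b m2 beta p : R) : R :=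
  if 4 * m2 < b ^+ 2 then -1 else -1 - (beta + 1) * p.

Definition Gamma_crit (R : realType) (b m2 beta p mu kappa t : R) : R :=
  mu * expR (r_crit b m2 beta p * t) * (1 + t) `^ kappa.

(* Main.v *)
Require Import Defs.
From mathcomp Require Import all_boot all_order all_algebra.
From mathcomp Require Import all_classical all_reals all_analysis.
From mathcomp Require Import measurable_realfun.
From mathcomp Require Import ring lra.
Import Order.TTheory GRing.Theory Num.Theory.
Import numFieldNormedType.Exports.
Local Open Scope classical_set_scope.
Local Open Scope ring_scope.

(** The space integral U of a solution satisfies, in the sense of an integral
    inequality, U'' + b U' + m2 U >= C Gamma |U|^q with q = (beta + 1) p.  Indeed
    the speed of propagation c exp (- H t) is integrable in time, so that the
    support stays in the fixed ball of radius r + c / H ([solution_vanishes]),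
    and Jensen's inequality bounds the p-mass of the solution below by a
    constant times U^p ([Lp_mass_ge]).

    The differential inequality itself is never written.  Instead, the weak
    identity at time t is tested with a function that equals, near the support, the
    solution of the adjoint ordinary differential equation which vanishes at time
    t with slope - 1; this gives a Duhamel formula for U t ([weak_duhamel]).
    Let a1 <= a2 be the roots of x^2 - b x + m2.  For V t = exp (a1 t) U t the
    choice of the critical exponent makes all exponentials cancel, and the
    formula becomes
<<
      V t >= eps (I0 + I1 k t) + C int_0^t k (t - s) (1 + s)^kappa V(s)^q ds
>>
    where I0 and I1 are the integrals of the data and where k x is
    (1 - exp (- (a2 - a1) x)) / (a2 - a1) if a1 < a2 and x if a1 = a2
    ([weighted_mass_base], [weighted_mass_step]).

    The blow-up comes from iterating this inequality on a single dyadic interval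
    [L, 2 L].  At time L one has V >= M0, with M0 of order eps if a1 < a2
    and eps L if a1 = a2.  The inequality then lets V double on successive
    intervals whose lengths form a geometric series of total length L, as soon as
    L^(kappa + 1) eps^(q - 1) (if a1 < a2), respectively
    L^(kappa + 1 + q) eps^(q - 1) (if a1 = a2), exceeds a constant
    ([doubling_blowup]).  The solution cannot survive until 2 L, and the smallest
    admissible L has the stated order in eps ([choose_scale],
    [lifespan_of_kernel]).  The condition kappa > kappa_crit says that the
    exponent of L is positive.

    Test functions have to be constructed: they are built from the flat function
    exp (- 1 / x) inside a class of functions stable under differentiation
    ([elementary_smooth], [product_test_function]). *)

Set Implicit Arguments.
Unset Strict Implicit.
Unset Printing Implicit Defensive.

(** * Smooth functions and cutoffs *)

(** Directional derivatives are derivatives along a line, so that the chain rule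
    for an outer function of one variable reduces to the one on the reals. *)
Lemma is_derive_line (R : realType) (V : normedModType R) (f : V -> R)
    (x v : V) (df : R) :
  is_derive x v f df <->
  is_derive (0 : R) (1 : R) (fun h : R => f (h *: v + x)) df.
Proof.
have E : (fun h : R => h^-1 *: ((f \o shift x) (h *: v) - f x)) =
  (fun h : R => h^-1 *: (((fun h : R => f (h *: v + x)) \o shift 0)
    (h *: (1 : R)) - f (0 *: v + x))).
  by apply/funext => h /=; rewrite addr0 scale0r add0r [_%:A]mulr1.
by split=> -[d1 d2]; apply: DeriveDef; move: d1 d2; rewrite /derivable /derive E.
Qed.

Lemma is_derive_comp1 (R : realType) (V : normedModType R) (g : R -> R)
    (f : V -> R) (x v : V) (dg df : R) :
  is_derive x v f df -> is_derive (f x) 1 g dg ->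
  is_derive x v (fun z => g (f z)) (dg * df).
Proof.
move=> /is_derive_line Df Dg; apply/is_derive_line.
apply: (@is_derive1_comp R g (fun h : R => f (h *: v + x)) 0 dg df _ Df).
by rewrite scale0r add0r.
Qed.

(** A class of functions that directional differentiation preserves.  Outer
    functions come as the whole sequence of their iterated derivatives, so that
    the derivative of a composition is again of the form gs k.+1 (f z) times an
    elementary function; all the orders of differentiation are then handled by
    one structural induction. *)
Inductive elementary (R : realType) (V : normedModType R) : (V -> R) -> Prop :=
| elementary_cst (a : R) : elementary (fun=> a)
| elementary_linear (l : V -> R) : continuous l ->
    (forall (h : R) v z, l (h *: v + z) = h * l v + l z) -> elementary l
| elementary_add f g : elementary f -> elementary g ->
    elementary (fun z => f z + g z)
| elementary_mul f g : elementary f -> elementary g ->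
    elementary (fun z => f z * g z)
| elementary_comp (gs : nat -> R -> R) (k : nat) f :
    (forall k (x : R), is_derive x 1 (gs k) (gs k.+1 x)) -> elementary f ->
    elementary (fun z => gs k (f z)).

Section elementary_smooth.
Context {R : realType} {V : normedModType R}.
Implicit Types f : V -> R.

Lemma elementary_continuous f : elementary f -> continuous f.
Proof.
elim=> {f} [a|l cl _ //|f g _ cf _ cg|f g _ cf _ cg|gs k f dgs _ cf] x.
- exact: cvg_cst.
- by apply: cvgD; [exact: cf|exact: cg].
- by apply: cvgM; [exact: cf|exact: cg].
- apply: (continuous_comp (cf x)).
  by apply/differentiable_continuous/derivable1_diffP; case: (dgs k (f x)).
Qed.

Lemma elementary_derive f (v : V) : elementary f ->
  exists2 df, elementary df & forall x, is_derive x v f (df x).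
Proof.
elim=> {f} [a|l cl ll|f g ef [df edf Df] eg [dg edg Dg]
  |f g ef [df edf Df] eg [dg edg Dg]|gs k f dgs ef [df edf Df]].
- by exists (fun=> 0) => [|x]; [exact: elementary_cst|exact: is_derive_cst].
- exists (fun=> l v) => [|x]; first exact: elementary_cst.
  apply/is_derive_line.
  rewrite (_ : (fun _ => _) = (fun h : R => h) * cst (l v) + cst (l x)).
    have := is_deriveD (is_deriveM (is_derive_id (0:R) 1)
      (is_derive_cst (l v) (0:R) 1)) (is_derive_cst (l x) (0:R) 1).
    by rewrite /= scaler0 add0r addr0 [_ *: _]mulr1.
  by apply/funext => h; rewrite ll.
- exists (fun z => df z + dg z) => [|x]; first exact: elementary_add.
  exact: is_deriveD.
- exists (fun z => f z * dg z + g z * df z) => [|x].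
    by apply: elementary_add; exact: elementary_mul.
  exact: is_deriveM.
- exists (fun z => gs k.+1 (f z) * df z) => [|x].
    by apply: elementary_mul => //; exact: elementary_comp.
  exact: is_derive_comp1.
Qed.

Lemma elementary_D f (v : V) : elementary f -> elementary ('D_v f).
Proof.
move=> /(elementary_derive v)[df edf Df].
by rewrite (_ : 'D_v f = df)//; apply/funext => x; rewrite derive_val.
Qed.

Lemma elementary_smooth f : elementary f -> smooth f.
Proof.
move=> + k; elim: k f => [|k IH] f ef /=; first exact: elementary_continuous.
split; first exact: elementary_continuous.
  by move=> x v; have [df _ Df] := elementary_derive v ef; case: (Df x).
by move=> v; apply: IH; exact: elementary_D.
Qed.

End elementary_smooth.

Lemma elementary_sum (R : realType) (V : normedModType R) (I : Type)
    (s : seq I) (F : I -> V -> R) :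
  (forall i, elementary (F i)) -> elementary (fun z => \sum_(i <- s) F i z).
Proof.
move=> eF; elim: s => [|i s IH].
  rewrite (_ : (fun _ => _) = (fun=> 0)); first exact: elementary_cst.
  by apply/funext => z; rewrite big_nil.
rewrite (_ : (fun _ => _) = (fun z => F i z + \sum_(i <- s) F i z)).
  exact: elementary_add.
by apply/funext => z; rewrite big_cons.
Qed.

Section flat.
Context {R : realType}.
Implicit Types P Q : {poly R}.

(** The classical flat functions: all derivatives of exp (- 1 / x), x > 0, have
    the form P (1 / x) exp (- 1 / x) with P a polynomial, extended by 0. *)
Definition flat P (x : R) : R :=
  if 0 < x then P.[x^-1] * expR (- x^-1) else 0.

(** Since y^(i + 1) exp (- y) <= (i + 1)! for y = 1 / x, a flat function is
    Lipschitz at the origin; this bound gives the continuity of flat ('X * P) at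
    0, which is the difference quotient of flat P there. *)
Lemma flat_le P : exists K : R, forall x, `|flat P x| <= K * `|x|.
Proof.
exists (\sum_(i < size P) `|P`_i| * i.+1`!%:R) => x; rewrite /flat.
case: ltP => x0; last first.
  by rewrite normr0 mulr_ge0// sumr_ge0// => i _; rewrite mulr_ge0.
have y0 : 0 < x^-1 by rewrite invr_gt0.
rewrite normrM (ger0_norm (expR_ge0 _)) horner_coef (gtr0_norm x0).
apply: (@le_trans _ _ ((\sum_(i < size P) `|P`_i| * x^-1 ^+ i) * expR (- x^-1))).
  rewrite ler_wpM2r ?expR_ge0// (le_trans (ler_norm_sum _ _ _))//.
  by apply: ler_sum => i _; rewrite normrM (ger0_norm (exprn_ge0 _ (ltW y0))).
rewrite !mulr_suml; apply: ler_sum => i _; rewrite -!mulrA ler_wpM2l//.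
have := expR_ge1Dxn i (ltW y0); set y := x^-1 in y0 *; move=> h.
rewrite expRN.
rewrite ler_pdivrMr ?expR_gt0// mulrAC -[x]invrK -/y ler_pdivlMr//.
rewrite -exprSr mulrC -ler_pdivrMr ?ltr0n ?fact_gt0//.
lra.
Qed.

Lemma flat_cvg0 P : flat P x @[x --> 0^'] --> (0 : R).
Proof.
have [K hK] := flat_le P.
apply/cvgr0Pnorm_le => e e0.
have K1 : 0 < `|K| + 1 by rewrite ltr_pwDr.
near=> x; apply: (le_trans (hK x)).
apply: (@le_trans _ _ ((`|K| + 1) * `|x|)).
  by rewrite ler_wpM2r// (le_trans (ler_norm _))// lerDl.
rewrite mulrC -ler_pdivlMr//; near: x.
by apply: dnbhs0_le; rewrite divr_gt0.
Unshelve. all: by end_near. Qed.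

Definition flat_deriv P : {poly R} := 'X^2 * (P - P^`()).

Lemma is_derive_flat P (x : R) : is_derive x 1 (flat P) (flat (flat_deriv P) x).
Proof.
have [x0|x0|<-] := ltgtP 0 x.
- apply: (@near_eq_is_derive R R R (fun x => P.[x^-1] * expR (- x^-1))).
    near=> y; rewrite /flat ifT//; near: y; exact: lt_nbhsr.
  have Di : is_derive x (1:R) (fun y : R => y^-1) (- (x ^- 2)).
    apply: DeriveDef.
      by apply: derivableV; [rewrite gt_eqF|exact: derivable_id].
    by rewrite deriveV ?gt_eqF// derive_id [_ *: _]mulr1.
  have DP : is_derive x (1:R) (fun y : R => P.[y^-1]) (P^`().[x^-1] * - (x ^- 2)).
    exact: (is_derive_comp1 Di (is_derive_poly P _)).
  have DE : is_derive x (1:R) (fun y : R => expR (- y^-1))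
      (expR (- x^-1) * (x ^- 2)).
    apply: (@is_derive_comp1 R R expR (fun y => - y^-1) x 1 (expR (- x^-1)) (x ^- 2) _ _).
    by rewrite -[X in is_derive _ _ _ X]opprK; exact: is_deriveN.
  rewrite /flat x0.
  rewrite (_ : _ * _ = P.[x^-1] *: (expR (- x^-1) * (x ^- 2)) +
    expR (- x^-1) *: (P^`().[x^-1] * - (x ^- 2))); first exact: is_deriveM.
  rewrite /flat_deriv !hornerE -exprVn /GRing.scale/=; ring.
- apply: (@near_eq_is_derive R R R (cst 0)).
    near=> y; rewrite /flat ltNge ifN// negbK ltW//; near: y; exact: lt_nbhsl.
  rewrite /flat ltNge (ltW x0)/=; exact: is_derive_cst.
- rewrite /flat ltxx.
  suff C : h^-1 *: ((flat P \o shift (0:R)) (h *: (1:R)) - flat P 0)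
      @[h --> (0:R)^'] --> (0:R).
    by apply: DeriveDef; [apply/cvg_ex; exists 0|apply/cvg_lim].
  rewrite (_ : (fun h => _) = flat ('X * P)); first exact: flat_cvg0.
  apply/funext => h /=; rewrite addr0 [_%:A]mulr1 /flat ltxx subr0.
  case: ifP => _; last by rewrite scaler0.
  by rewrite hornerM hornerX -mulrA.
Unshelve. all: by end_near. Qed.

Definition flats (k : nat) : R -> R := flat (iter k flat_deriv 1).

Lemma is_derive_flats k (x : R) : is_derive x 1 (flats k) (flats k.+1 x).
Proof. exact: is_derive_flat. Qed.

Lemma flatsE x : flats 0 x = if 0 < x then expR (- x^-1) else 0.
Proof. by rewrite /flats /flat/= hornerE mul1r. Qed.

(** A smooth step, equal to 1 on the negative half-line and to 0 beyond 1.  It is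
    obtained by composing the flat function with itself: flat x is constant for
    x <= 0, and flat (flat 1 - flat x) vanishes once flat x >= flat 1. *)
Definition cutoff (x : R) : R := flats 0 (flats 0 1 - flats 0 x) / flats 0 (flats 0 1).

Lemma flats_gt0 x : 0 < x -> 0 < flats 0 x.
Proof. by move=> x0; rewrite flatsE x0 expR_gt0. Qed.

Lemma flats_ge0 x : 0 <= flats 0 x.
Proof. by rewrite flatsE; case: ifP => // _; exact: expR_ge0. Qed.

Lemma cutoff1 x : x <= 0 -> cutoff x = 1.
Proof.
move=> x0; rewrite /cutoff (flatsE x) ltNge x0/= subr0 divff//.
by rewrite gt_eqF// !flats_gt0.
Qed.

Lemma cutoff0 x : 1 <= x -> cutoff x = 0.
Proof.
move=> x1; rewrite /cutoff [flats 0 (_ - _)]flatsE ifN ?mul0r// -leNgt subr_le0.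
have x0 : 0 < x by exact: lt_le_trans x1.
by rewrite !flatsE x0 ltr01 ler_expR lerN2 invr1 invf_le1.
Qed.

Lemma cutoff_ge0 x : 0 <= cutoff x.
Proof. by rewrite divr_ge0// flats_ge0. Qed.

Lemma elementary_cutoff (V : normedModType R) (f : V -> R) :
  elementary f -> elementary (fun z => cutoff (f z)).
Proof.
move=> ef; apply: elementary_mul; last exact: elementary_cst.
apply: (@elementary_comp _ _ flats 0%N) => //; first exact: is_derive_flats.
apply: elementary_add; first exact: elementary_cst.
rewrite (_ : (fun _ => _) = (fun z => (-1) * flats 0 (f z))); last first.
  by apply/funext => z; rewrite mulN1r.
apply: elementary_mul; first exact: elementary_cst.
by apply: elementary_comp => //; exact: is_derive_flats.
Qed.

End flat.

(** * Borel sets and supports in R^n *)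

Section rV_borel.
Context {R : realType} {n : nat}.
Local Notation space := 'rV[R]_n.

(** A countable base of the topology; it ties the topology of the space to the
    sigma-algebra generated by the coordinates and to null sets. *)
Definition rat_box (k : 'rV[rat]_n * nat) : set space :=
  [set x | forall i, `|x ord0 i - ratr (k.1 ord0 i)| < k.2.+1%:R^-1].

Lemma open_rat_box (O : set space) (x : space) : open O -> O x ->
  exists2 k, rat_box k x & rat_box k `<=` O.
Proof.
move=> oO Ox; have /nbhs_ballP[e /= e0 xO] : nbhs x O by exact: open_nbhs_nbhs.
have e2 : 0 < e / 2 by rewrite divr_gt0.
have [N hN] : exists N : nat, N.+1%:R^-1 < e / 2.
  have [N _ /(_ N (leqnn N)) hN] := near_infty_natSinv_lt (PosNum e2).
  by exists N.
have d0 : 0 < N.+1%:R^-1 :> R by rewrite invr_gt0.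
have /choice[q hq] (i : 'I_n) : exists q : rat, `|x ord0 i - ratr q| < N.+1%:R^-1.
  have [|q] := @rat_in_itvoo _ (x ord0 i - N.+1%:R^-1) (x ord0 i + N.+1%:R^-1).
    by rewrite ltrD2l gtrN.
  by rewrite in_itv/= => /andP[q1 q2]; exists q; rewrite distrC ltr_distl q1 q2.
exists (\row_i q i, N) => [i|y hy]; first by rewrite /= mxE.
apply: xO; split=> // i j; rewrite (ord1 i).
have := hy j; have := hq j; rewrite /= mxE -ball_normE /= => h1 h2.
rewrite -(subrKA (ratr (q j))) (le_lt_trans (ler_normD _ _))//.
by rewrite [ltRHS]splitr ltrD// ?(lt_trans h1)// distrC (lt_trans h2).
Qed.

Lemma measurable_coord_box (A : 'I_n -> set R) : (forall i, measurable (A i)) ->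
  measurable [set x : space | forall i, A i (x ord0 i)].
Proof.
move=> mA.
rewrite (_ : [set x | _] = \big[setI/setT]_(i < n)
    (fun x : space => x ord0 i) @^-1` A i).
  apply: bigsetI_measurable => i _.
  by rewrite -[X in measurable X]setTI; exact: measurable_coord.
rewrite -bigcap_seq; apply/seteqP; split => x /= Ax i.
  by move=> _; exact: Ax.
by apply: (Ax i); rewrite /= mem_index_enum.
Qed.

Lemma measurable_rat_box k : measurable (rat_box k).
Proof.
apply: (@measurable_coord_box
  (fun i => [set y : R | `|y - ratr (k.1 ord0 i)| < k.2.+1%:R^-1])) => i.
apply: open_measurable; rewrite (_ : [set y | _] = ball (ratr (k.1 ord0 i) : R) k.2.+1%:R^-1).
  exact: ball_open.
by apply/seteqP; split => y; rewrite -ball_normE /= distrC.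
Qed.

Lemma measurable_open (O : set space) : open O -> measurable O.
Proof.
move=> oO; pose F m := if @unpickle ('rV[rat]_n * nat)%type m is Some k then
  (if `[< rat_box k `<=` O >] then rat_box k else set0) else set0.
rewrite (_ : O = \bigcup_m F m).
  apply: bigcupT_measurable => m; rewrite /F; case: unpickle => [k|]//.
  by case: ifP => // _; exact: measurable_rat_box.
apply/seteqP; split => [x Ox|x [m _]]; last first.
  rewrite /F; case: unpickle => [k|]//; case: ifPn => // /asboolP; exact.
have [k kx kO] := open_rat_box oO Ox.
by exists (pickle k) => //; rewrite /F pickleK; case: asboolP.
Qed.

Lemma measurable_continuous (f : space -> R) : continuous f ->
  measurable_fun setT f.
Proof.
move=> cf; apply: (measurability _ (RGenOpens.measurableE R)).
move=> _ [_ [a [b ->] <-]]; rewrite setTI; apply: measurable_open.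
by apply: open_comp; [move=> x _; exact: cf|exact: interval_open].
Qed.

(** The complement of the essential support is an uncountable union of open sets
    on which f vanishes almost everywhere; the rational boxes contained in one
    of them reduce it to a countable union. *)
Lemma ess_supp_ae (f : space -> R) :
  {ae leb R n, forall x, ~ ess_supp f x -> f x = 0}.
Proof.
pose P k := {ae leb R n, forall x, rat_box k x -> f x = 0}.
pose F m := if @unpickle ('rV[rat]_n * nat)%type m is Some k then
  (if `[< P k >] then [set x | rat_box k x /\ f x <> 0] else set0) else set0.
have : (leb R n).-negligible (\bigcup_m F m).
  apply: negligible_bigcup => m; rewrite /F; case: unpickle => [k|]; last first.
    exact: negligible_set0.
  case: ifPn => [/asboolP|_]; last exact: negligible_set0.
  by apply: negligibleS => x /= [kx fx] /(_ kx).
apply: negligibleS => x /= /not_implyP[/contrapT nx fx].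
case: nx => O [oO O0] Ox.
have [k kx kO] := open_rat_box oO Ox.
exists (pickle k) => //; rewrite /F pickleK; case: asboolP => // -[].
by apply: filterS O0 => y Oy /kO.
Qed.

Definition cube (r : R) : set space :=
  [set x | forall i, `[- r, r]%classic (x ord0 i)].

Lemma cube_compact (r : R) : compact (cube r).
Proof. by apply: (@rV_compact R n (fun=> `[- r, r]%classic)) => i; exact: segment_compact. Qed.

Lemma measurable_cube (r : R) : measurable (cube r).
Proof. by apply: (@measurable_coord_box (fun=> `[- r, r]%classic)). Qed.

Lemma leb_cube (r : R) : 0 <= r -> leb R n (cube r) = ((2 * r) ^+ n)%:E.
Proof.
move=> r0; rewrite /cube [LHS](@leb_box R n (fun=> `[- r, r]%classic))//.
under eq_bigr do rewrite lebesgue_measure_itv/= lte_fin.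
rewrite (eq_bigr (fun=> (2 * r)%:E)).
  by rewrite prodEFin prodr_const card_ord.
move=> i _; have [rr|] := ltP (- r) r; first by rewrite -EFinB; congr EFin; ring.
by rewrite -subr_ge0 -opprD oppr_ge0 => ?; congr EFin; lra.
Qed.

Lemma eball_cube (r : R) : eball r `<=` cube r.
Proof.
move=> x; rewrite /eball /enorm /= => xr i.
rewrite /= in_itv/= -ler_norml (le_trans _ xr)// -sqrtr_sqr ler_wsqrtr//.
by rewrite (bigD1 i)//= lerDl sumr_ge0// => j _; exact: sqr_ge0.
Qed.

Lemma subset_eball (r1 r2 : R) : r1 <= r2 ->
  (eball r1 : set space) `<=` eball r2.
Proof. by move=> r12 x /le_trans; apply. Qed.

Lemma L1loc_integrable (f : space -> R) (r : R) : L1loc f ->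
  {ae leb R n, forall x, ~ eball r x -> f x = 0} ->
  (leb R n).-integrable setT (EFin \o f).
Proof.
move=> [mf fK] f0; apply/integrableP; split; first exact/measurable_EFinP.
rewrite (_ : \int[_]_(x in _) _ = \int[leb R n]_(x in cube r) `|f x|%:E)%E.
  exact/fK/cube_compact.
rewrite [RHS]integral_mkcond; apply: ae_eq_integral => //.
- by apply/measurable_EFinP; exact: measurableT_comp.
- apply/(measurable_restrictT _ (measurable_cube r)).
  by apply/measurable_funTS/measurable_EFinP; exact: measurableT_comp.
- apply: filterS f0 => x fx _; rewrite patchE; case: ifPn => //.
  rewrite notin_setE => nx; rewrite /= fx ?normr0//.
  by move=> /eball_cube.
Qed.

(** How a test function that is constant on the support of f disappears from an
    integral. *)
Lemma integral_mul_cst (f g : space -> R) (S : set space) (a : R) :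
  (leb R n).-integrable setT (EFin \o f) -> continuous g ->
  {ae leb R n, forall x, ~ S x -> f x = 0} -> (forall x, S x -> g x = a) ->
  (\int[leb R n]_x (f x * g x)%:E = a%:E * \int[leb R n]_x (f x)%:E)%E.
Proof.
move=> If cg f0 ga.
have mf : measurable_fun setT f.
  by have /measurable_int/measurable_EFinP := If.
rewrite -integralZl//; apply: ae_eq_integral => //.
- by apply/measurable_EFinP/measurable_funM => //; exact: measurable_continuous.
- by apply/measurable_EFinP/measurable_funM.
- apply: filterS f0 => x fx _; have [Sx|nSx] := pselect (S x).
    by rewrite ga// -EFinM mulrC.
  by rewrite fx// mul0r mule0.
Qed.

End rV_borel.

(** * Lower bounds for the nonlinear term *)

(** Lebesgue integrals of nonnegative functions are suprema over simple
    functions, so that this bound requires no measurability of f; in particular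
    it applies to the source term as a function of time. *)
Lemma ge0_le_integral_cst (d : measure_display) (T : measurableType d)
    (R : realType) (mu : {measure set T -> \bar R}) (D A : set T)
    (f : T -> \bar R) (a : R) :
  (forall x, D x -> (0 <= f x)%E) -> measurable A -> A `<=` D -> 0 <= a ->
  (forall x, A x -> (a%:E <= f x)%E) ->
  (a%:E * mu A <= \int[mu]_(x in D) f x)%E.
Proof.
move=> f0 mA AD a0 fa.
rewrite -integral_cst// integral_mkcond [leRHS]integral_mkcond.
have g0 x : (0 <= ((cst a%:E) \_ A) x)%E.
  by apply: erestrict_ge0 => y _; rewrite lee_fin.
rewrite !ge0_integralTE//; last exact: erestrict_ge0.
apply: le_ereal_sup => _ [h hg <-]; exists h => // x; apply: le_trans (hg x) _.
rewrite !patchE; case: ifPn => [/set_mem Ax|_].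
  by rewrite mem_set ?fa//; exact: AD.
by case: ifPn => // /set_mem /f0.
Qed.

Section Lp_mass_bounds.
Context {R : realType} {n : nat}.
Local Notation space := 'rV[R]_n.

(** The constant in the lower bound of the p-mass of a function supported in the
    ball of radius rho; (2 rho)^n is the volume of the enclosing cube. *)
Definition jensen_cst (p rho : R) : R := ((2 * (2 * rho) ^+ n) `^ (p - 1))^-1 / 2.

Lemma jensen_cst_gt0 (p rho : R) : 0 < rho -> 0 < jensen_cst p rho.
Proof. by move=> r0; rewrite divr_gt0// invr_gt0 powR_gt0// !(mulr_gt0, exprn_gt0). Qed.

(** A form of Jensen's inequality, up to the constant.  It follows by integrating
    the pointwise bound |y| <= a + a^(1 - p) |y|^p over the cube, with a half of
    the mean value w / |cube|. *)
Lemma Lp_mass_ge (p rho w : R) (v : space -> R) : 1 < p -> 0 < rho -> 0 < w ->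
  (leb R n).-integrable setT (EFin \o v) ->
  {ae leb R n, forall x, ~ eball rho x -> v x = 0} ->
  (w%:E <= \int[leb R n]_x (v x)%:E)%E ->
  ((jensen_cst p rho * w `^ p)%:E <= Lp_mass p v)%E.
Proof.
move=> p1 r0 w0 Iv v0 wv.
have mv : measurable_fun setT v.
  by have /measurable_int/measurable_EFinP := Iv.
set K : R := (2 * rho) ^+ n.
have K0 : 0 < K by rewrite exprn_gt0// mulr_gt0.
(* With this a, the contribution of a to the integral over the cube is w / 2. *)
pose a := w / (2 * K).
have a0 : 0 < a by rewrite divr_gt0// mulr_gt0.
have ap0 : 0 < a `^ (p - 1) by rewrite powR_gt0.
have young (y : R) : `|y| <= a + (a `^ (p - 1))^-1 * `|y| `^ p.
  have [ya|ay] := leP `|y| a.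
    by rewrite (le_trans ya)// lerDl mulr_ge0// ?powR_ge0// invr_ge0 ltW.
  have y0 : 0 < `|y| by exact: lt_trans ay.
  rewrite -(mulr_powRB1 (ltW y0)); last by lra.
  apply: (@le_trans _ _ ((a `^ (p - 1))^-1 * (`|y| * `|y| `^ (p - 1)))).
    rewrite ler_pdivlMl// mulrC ler_pM2l//.
    by apply: ge0_ler_powR; rewrite ?nnegrE ?(ltW a0) ?(ltW y0) ?(ltW ay)//; lra.
  by rewrite lerDr ltW.
have mP : measurable_fun setT (fun x => `|v x| `^ p).
  apply: (measurableT_comp (measurable_powR p)); exact: measurableT_comp.
have : (w%:E <= (w / 2)%:E + ((a `^ (p - 1))^-1)%:E * Lp_mass p v)%E.
  apply: (le_trans wv).
  apply: (@le_trans _ _ (\int[leb R n]_x (a%:E * (\1_(cube rho) x)%:E +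
      ((a `^ (p - 1))^-1)%:E * (`|v x| `^ p)%:E))%E).
    apply: (@le_trans _ _ (\int[leb R n]_x `|v x|%:E)%E).
      apply: le_integral => //; first exact: integrable_abse Iv.
      by move=> x _; rewrite lee_fin ler_norm.
    apply: ae_ge0_le_integral => //.
    - by apply/measurable_EFinP; exact: measurableT_comp.
    - move=> x _; rewrite -!EFinM -EFinD lee_fin indicE.
      apply: addr_ge0; apply: mulr_ge0; rewrite ?ler0n ?powR_ge0 ?(ltW a0)//.
      by rewrite invr_ge0 ltW.
    - apply: emeasurable_funD; apply/measurable_EFinP; apply: measurable_funM => //.
      by apply: measurable_indic; exact: measurable_cube.
    - apply: filterS v0 => x vx _.
      rewrite -!EFinM -EFinD lee_fin indicE.
      have [/set_mem cx|/negP] := boolP (x \in cube rho); first by rewrite mulr1.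
      rewrite mulr0 add0r => nc; rewrite vx ?normr0.
        by rewrite mulr_ge0 ?powR_ge0// invr_ge0 ltW.
      by move=> /eball_cube cx; apply: nc; rewrite inE.
  rewrite ge0_integralD//; last first.
  - by apply/measurable_EFinP; exact: measurable_funM.
  - by move=> x _; rewrite -EFinM lee_fin mulr_ge0 ?powR_ge0// invr_ge0 ltW.
  - apply/measurable_EFinP; apply: measurable_funM => //.
    by apply: measurable_indic; exact: measurable_cube.
  - by move=> x _; rewrite -EFinM lee_fin indicE mulr_ge0 ?ler0n// ltW.
  rewrite !ge0_integralZl_EFin//; last first.
  - exact: ltW.
  - by apply/measurable_EFinP/measurable_indic; exact: measurable_cube.
  - by rewrite invr_ge0 ltW.
  - exact/measurable_EFinP.
  rewrite integral_indic//; last exact: measurable_cube.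
  rewrite setIT leeD2r//.
  rewrite [X in (_ * X <= _)%E](_ : _ = K%:E); last exact/leb_cube/ltW.
  rewrite -EFinM lee_fin /a.
  by rewrite le_eqVlt; apply/orP; left; apply/eqP; field; rewrite gt_eqF.
rewrite /jensen_cst -/K -/(Lp_mass p v).
case: (Lp_mass p v) => [P| |]; last 2 first.
- by rewrite leey.
- rewrite gt0_muleNy ?lte_fin ?invr_gt0//.
rewrite -EFinM -EFinD !lee_fin => h.
have {h} : a `^ (p - 1) * (w / 2) <= P.
  rewrite mulrC -ler_pdivlMr// mulrC; lra.
apply: le_trans.
have K2 : 0 < 2 * K by rewrite mulr_gt0.
have -> : a `^ (p - 1) = w `^ (p - 1) * ((2 * K) `^ (p - 1))^-1.
  rewrite /a powRM ?invr_ge0 ?(ltW w0) ?(ltW K2)//.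
  by rewrite -[(2 * K)^-1]powR_inv1 ?(ltW K2)// -powRrM mulN1r powRN.
rewrite -(mulr_powRB1 (ltW w0)); last by lra.
by rewrite le_eqVlt; apply/orP; left; apply/eqP; ring.
Qed.

(** On the support of v the test function is the constant lam, so that the two
    factors containing v combine into the power beta + 1 of its p-mass. *)
Lemma nonlinear_term_ge (p beta rho w gam lam : R) (v g : space -> R) :
  1 < p -> 0 <= beta -> 0 < rho -> 0 < w -> 0 <= gam -> 0 <= lam ->
  (leb R n).-integrable setT (EFin \o v) ->
  {ae leb R n, forall x, ~ eball rho x -> v x = 0} ->
  (w%:E <= \int[leb R n]_x (v x)%:E)%E ->
  continuous g -> (forall x, 0 <= g x) -> (forall x, eball rho x -> g x = lam) ->
  ((gam * lam * (jensen_cst p rho * w `^ p) `^ (beta + 1))%:E <=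
   gam%:E * Lp_mass p v `^ beta * \int[leb R n]_x (`|v x| `^ p * g x)%:E)%E.
Proof.
move=> p1 b0 r0 w0 gam0 lam0 Iv v0 wv cg g0 glam.
have mv : measurable_fun setT v.
  by have /measurable_int/measurable_EFinP := Iv.
have mP : measurable_fun setT (fun x => `|v x| `^ p).
  apply: (measurableT_comp (measurable_powR p)); exact: measurableT_comp.
have -> : (\int[leb R n]_x (`|v x| `^ p * g x)%:E = lam%:E * Lp_mass p v)%E.
  rewrite -ge0_integralZl_EFin//; last exact/measurable_EFinP.
  apply: ae_eq_integral => //.
  - by apply/measurable_EFinP/measurable_funM => //; exact: measurable_continuous.
  - by apply/measurable_EFinP/measurable_funM.
  - apply: filterS v0 => x vx _; have [Sx|nSx] := pselect (eball rho x).
      by rewrite glam// -EFinM mulrC.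
    by rewrite vx// normr0 powR0 ?mul0r ?mule0// gt_eqF//; lra.
have := Lp_mass_ge p1 r0 w0 Iv v0 wv.
set P := Lp_mass p v; set z := jensen_cst p rho * w `^ p => zP.
have z0 : 0 < z by rewrite mulr_gt0 ?powR_gt0// jensen_cst_gt0.
have P0 : (0 <= P)%E by apply: le_trans zP; rewrite lee_fin ltW.
have -> : (gam * lam * z `^ (beta + 1))%:E =
    (gam%:E * (z `^ beta)%:E * (lam%:E * z%:E))%E.
  rewrite -!EFinM; congr EFin; rewrite powRD; last by rewrite (gt_eqF z0) implybT.
  by rewrite powRr1 ?(ltW z0)//; ring.
apply: lee_pmul.
- by rewrite -EFinM lee_fin mulr_ge0// powR_ge0.
- by rewrite -EFinM lee_fin mulr_ge0// ltW.
- apply: lee_wpmul2l; first by rewrite lee_fin.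
  rewrite -poweR_EFin; apply: gt0_ler_poweR => //.
    by rewrite in_itv/= leey lee_fin (ltW z0).
  by rewrite in_itv/= leey P0.
- by apply: lee_wpmul2l => //; rewrite lee_fin.
Qed.

End Lp_mass_bounds.

(** * Test functions depending only on time near the support *)

Section test_function.
Context {R : realType} {n : nat}.
Local Notation space := 'rV[R]_n.
Local Notation spacetime := (R * 'rV[R]_n)%type.

Definition sqnorm (x : space) : R := \sum_i x ord0 i ^+ 2.

Lemma eball_sqnorm (r : R) (x : space) : 0 <= r ->
  eball r x <-> sqnorm x <= r ^+ 2.
Proof.
move=> r0; rewrite /eball /enorm /= -/(sqnorm x).
have x0 : 0 <= sqnorm x by rewrite sumr_ge0// => i _; exact: sqr_ge0.
split=> h; last by rewrite -(ger0_norm r0) -sqrtr_sqr ler_wsqrtr.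
by rewrite -[leLHS](sqr_sqrtr x0) lerXn2r ?nnegrE.
Qed.

Definition bump (t1 t2 rho : R) (z : spacetime) : R :=
  cutoff ((z.1 ^+ 2 - t1 ^+ 2) / (t2 ^+ 2 - t1 ^+ 2)) *
  cutoff (sqnorm z.2 - rho ^+ 2).

(** An open set on which bump equals 1; being open, it also carries the
    derivatives of all orders. *)
Definition plateau (t1 rho : R) : set spacetime :=
  [set z | z.1 ^+ 2 < t1 ^+ 2 /\ sqnorm z.2 < rho ^+ 2].

Lemma elementary_time : elementary (fun z : spacetime => z.1).
Proof. by apply: elementary_linear => // z; exact: cvg_fst. Qed.

Lemma elementary_sqnorm : elementary (fun z : spacetime => sqnorm z.2).
Proof.
apply: elementary_sum => i.
have ei : elementary (fun z : spacetime => z.2 ord0 i).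
  apply: elementary_linear => [z|h v z]; last by rewrite /= !mxE.
  apply: (@continuous_comp _ _ _ snd (fun x : space => x ord0 i)).
    exact: cvg_snd.
  exact: coord_continuous.
by under eq_fun do rewrite expr2; exact: elementary_mul.
Qed.

Lemma elementary_bump (t1 t2 rho : R) : elementary (bump t1 t2 rho).
Proof.
apply: elementary_mul; apply: elementary_cutoff.
  apply: elementary_mul; last exact: elementary_cst.
  apply: elementary_add; last exact: elementary_cst.
  under eq_fun do rewrite expr2; apply: elementary_mul; exact: elementary_time.
by apply: elementary_add; [exact: elementary_sqnorm|exact: elementary_cst].
Qed.

Lemma bump_ge0 (t1 t2 rho : R) z : 0 <= bump t1 t2 rho z.
Proof. by rewrite mulr_ge0// cutoff_ge0. Qed.

Lemma bump_plateau (t1 t2 rho : R) z : 0 < t1 -> t1 < t2 ->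
  plateau t1 rho z -> bump t1 t2 rho z = 1.
Proof.
move=> t10 t12 [zt zx]; rewrite /bump !cutoff1 ?mulr1//.
  by rewrite subr_le0 ltW.
rewrite mulr_le0_ge0 ?subr_le0 ?invr_ge0 ?subr_ge0//; first exact: ltW.
by rewrite lerXn2r ?nnegrE ?ltW// (lt_trans t10).
Qed.

Lemma bump_support (t1 t2 rho : R) z : 0 < t1 -> t1 < t2 -> 0 < rho ->
  bump t1 t2 rho z != 0 -> (`[- t2, t2]%classic `*` cube (rho + 1)) z.
Proof.
move=> t10 t12 r0; rewrite mulf_eq0 negb_or => /andP[h1 h2].
have t20 : 0 < t2 by exact: lt_trans t12.
split => /=.
  rewrite in_itv/= -ler_norml -(@ler_pXn2r _ 2) ?nnegrE ?(ltW t20)// real_normK ?num_real//.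
  rewrite leNgt; apply/negP => tz; move/eqP: h1; apply; apply: cutoff0.
  rewrite ler_pdivlMr ?mul1r ?lerD2r ?(ltW tz)//.
  by rewrite subr_gt0 ltr_pXn2r ?nnegrE ?ltW.
apply: eball_cube; apply/eball_sqnorm; first by rewrite addr_ge0// ltW.
have : sqnorm z.2 < rho ^+ 2 + 1.
  rewrite ltNge; apply/negP => hz; move/eqP: h2; apply; apply: cutoff0; lra.
move=> /ltW/le_trans; apply; rewrite sqrrD expr1n mulr1 -addrA lerD2l lerDr.
by rewrite mulrn_wge0// ltW.
Qed.

Lemma open_plateau (t1 rho : R) : open (plateau t1 rho).
Proof.
apply: openI.
  apply: (@open_comp _ _ (fun z : spacetime => z.1 ^+ 2) [set y | y < t1 ^+ 2]).
    move=> z _; apply: (elementary_continuous (f := fun z : spacetime => z.1 ^+ 2)).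
    by under eq_fun do rewrite expr2; apply: elementary_mul; exact: elementary_time.
  exact: open_lt.
apply: (@open_comp _ _ (fun z : spacetime => sqnorm z.2) [set y | y < rho ^+ 2]).
  by move=> z _; apply: elementary_continuous; exact: elementary_sqnorm.
exact: open_lt.
Qed.

Variables (ls : nat -> R -> R).
Hypothesis dls : forall k (x : R), is_derive x 1 (ls k) (ls k.+1 x).
Variables (t1 t2 rho : R).
Hypotheses (t10 : 0 < t1) (t12 : t1 < t2) (rho0 : 0 < rho).

(** On the plateau this test function is the function ls 0 of time only, so that
    the wave operator reduces there to an ordinary differential operator. *)
Definition product_test : spacetime -> R :=
  fun z => ls 0%N z.1 * bump t1 t2 rho z.

Lemma elementary_ls k : elementary (fun z : spacetime => ls k z.1).
Proof. by apply: elementary_comp => //; exact: elementary_time. Qed.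

Lemma elementary_product_test : elementary product_test.
Proof. by apply: elementary_mul; [exact: elementary_ls|exact: elementary_bump]. Qed.

Lemma product_test_function (T : \bar R) : (t2%:E < T)%E ->
  test_function T product_test.
Proof.
move=> t2T.
have cK : compact (`[- t2, t2]%classic `*` cube (rho + 1) : set spacetime).
  by apply: compact_setX; [exact: segment_compact|exact: cube_compact].
have clK : closure [set z | product_test z != 0] `<=`
    (`[- t2, t2]%classic `*` cube (rho + 1) : set spacetime).
  rewrite [X in _ `<=` X](closure_id _).1; last first.
    by apply: compact_closed => //; exact: norm_hausdorff.
  apply: closureS => z /=; rewrite mulf_eq0 negb_or => /andP[_].
  exact: bump_support.
split.
- exact/elementary_smooth/elementary_product_test.
- by apply: subclosed_compact clK => //; exact: closed_closure.
- move=> z /clK[/= + _]; rewrite in_itv/= => /andP[_ z2].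
  by apply: le_lt_trans t2T; rewrite lee_fin.
Qed.

Lemma product_test_plateau z : plateau t1 rho z -> product_test z = ls 0 z.1.
Proof. by move=> pz; rewrite /product_test bump_plateau ?mulr1. Qed.

Lemma derive_plateau (f g : spacetime -> R) (v z : spacetime) :
  (forall z, plateau t1 rho z -> f z = g z) -> plateau t1 rho z ->
  'D_v f z = 'D_v g z.
Proof.
move=> fg pz; apply: near_eq_derive.
near=> y; apply: fg; near: y.
by apply: open_nbhs_nbhs; split; [exact: open_plateau|].
Unshelve. all: by end_near. Qed.

Lemma derive_ls k (v z : spacetime) :
  'D_v (fun z : spacetime => ls k z.1) z = ls k.+1 z.1 * v.1.
Proof.
have D1 : is_derive z v (fun z : spacetime => z.1) v.1.
  apply/is_derive_line.
  rewrite (_ : (fun _ => _) = (fun h : R => h) * cst v.1 + cst z.1).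
    have := is_deriveD (is_deriveM (is_derive_id (0:R) 1)
      (is_derive_cst v.1 (0:R) 1)) (is_derive_cst z.1 (0:R) 1).
    by rewrite /= scaler0 add0r addr0 [_ *: _]mulr1.
  by apply/funext => h.
by have [_] := is_derive_comp1 D1 (dls k z.1).
Qed.

Lemma dt_product_test z : plateau t1 rho z -> dt product_test z = ls 1 z.1.
Proof.
move=> pz; rewrite /dt (derive_plateau (g := fun z => ls 0 z.1))//.
  by rewrite derive_ls mulr1.
exact: product_test_plateau.
Qed.

Lemma dtt_product_test z : plateau t1 rho z ->
  dt (dt product_test) z = ls 2 z.1.
Proof.
move=> pz; rewrite {1}/dt (derive_plateau (g := fun z => ls 1 z.1))//.
  by rewrite derive_ls mulr1.
exact: dt_product_test.
Qed.

Lemma laplacian_product_test z : plateau t1 rho z ->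
  laplacian product_test z = 0.
Proof.
move=> pz; rewrite /laplacian big1// => i _.
rewrite {1}/dx (derive_plateau (g := cst 0))//; first by rewrite derive_cst.
move=> {pz}z pz; rewrite /dx (derive_plateau (g := fun z => ls 0 z.1))//.
  by rewrite derive_ls mulr0.
exact: product_test_plateau.
Qed.

End test_function.

Lemma elementary_slice_continuous (R : realType) (n : nat)
    (f : R * 'rV[R]_n -> R) (s : R) :
  elementary f -> continuous (fun x => f (s, x)).
Proof.
move=> /elementary_continuous cf x.
apply: (@continuous_comp _ _ _ (fun x => (s, x)) f); last exact: cf.
apply: (@cvg_pair _ _ _ (nbhs x) (nbhs s) (nbhs x) _ _ _ (fun=> s) id).
  exact: cvg_cst.
exact: cvg_id.
Qed.

(** * Duhamel formula for the space integral *)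

Lemma lte_between (R : realType) (t : R) (T : \bar R) : (t%:E < T)%E ->
  exists2 t2 : R, t < t2 & (t2%:E < T)%E.
Proof.
case: T => [T| |] //; last by exists (t + 1); rewrite ?ltry// ltrDl.
rewrite lte_fin => tT; exists ((t + T) / 2); rewrite ?lte_fin; lra.
Qed.

Lemma integral_singleton (R : realType) (t : R) (h : R -> \bar R) : 0 <= t ->
  (forall s, 0 < s -> s <= t -> h s = 0%E) ->
  (\int[@lebesgue_measure R]_(s in `[0%R, t]) h s = 0)%E.
Proof.
move=> t0 h0; pose g : R -> \bar R := (cst (h 0)) \_ [set 0].
transitivity (\int[@lebesgue_measure R]_(s in `[0%R, t]) g s)%E.
  apply: eq_integral => s /set_mem/=; rewrite in_itv/= => /andP[s0 st].
  rewrite /g patchE; case: ifPn => [/set_mem ->//|].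
  rewrite notin_setE => s1; rewrite h0// lt_neqAle s0 andbT.
  by apply/eqP => s2; apply: s1.
rewrite /g -integral_mkcondr integral_cst; last exact: measurableI.
have -> : `[0, t] `&` [set 0] = [set 0] :> set R.
  by apply/seteqP; split => [x []//|x /= ->]; rewrite in_itv/= lexx t0.
rewrite [X in (_ * X)%E](_ : _ = 0%E) ?mule0//.
exact: lebesgue_measure_set1.
Qed.

Section duhamel.
Context {R : realType} {n : nat}.
Local Notation space := 'rV[R]_n.
Variables (c H b m2 beta p eps r : R) (Gamma : R -> R).
Variables (u0 u1 : space -> R) (T : \bar R) (u : R -> space -> R).
Hypotheses (c0 : 0 < c) (H0 : 0 < H) (r0 : 0 < r).
Hypothesis wu : weak_solution c H b m2 beta p Gamma eps r u0 u1 T u.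

Let rho := r + c / H.

Let rho_gt0 : 0 < rho.
Proof. by rewrite addr_gt0// divr_gt0. Qed.

(** The light cone never leaves the ball of radius r + c / H, because the
    amplitude A_dS is bounded by c / H: the volume of the support of the solution
    is bounded uniformly in time. *)
Lemma solution_vanishes t : 0 < t -> (t%:E < T)%E ->
  {ae leb R n, forall x, ~ eball rho x -> u t x = 0}.
Proof.
move=> t0 tT; have [ut _ [_ /(_ t t0 tT) supp _]] := wu.
apply: filterS (ess_supp_ae (u t)) => x + nx; apply => /supp.
move=> /(subset_eball _) hx; apply/nx/hx.
by rewrite lerD2l /A_dS ger_pMr ?divr_gt0//.
Qed.

Lemma solution_integrable t : 0 < t -> (t%:E < T)%E ->
  (leb R n).-integrable setT (EFin \o u t).
Proof.
move=> t0 tT; apply: L1loc_integrable (solution_vanishes t0 tT).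
have [ut [C0 _ _] _] := wu.
by have [] := C0 t; first by split => //; exact: ltW.
Qed.

Variables (ls : nat -> R -> R) (t : R).
Hypothesis dls : forall k (x : R), is_derive x 1 (ls k) (ls k.+1 x).
Hypothesis ode : forall s, ls 2 s - b * ls 1 s + m2 * ls 0 s = 0.
Hypotheses (lst : ls 0 t = 0) (lst1 : ls 1 t = -1).
Hypothesis ls_ge0 : forall s, s <= t -> 0 <= ls 0 s.
Hypotheses (t0 : 0 < t) (tT : (t%:E < T)%E).
Hypothesis I0 : (leb R n).-integrable setT (EFin \o u0).
Hypothesis I1 : (leb R n).-integrable setT (EFin \o u1).
Hypothesis u00 : {ae leb R n, forall x, ~ eball r x -> u0 x = 0}.
Hypothesis u10 : {ae leb R n, forall x, ~ eball r x -> u1 x = 0}.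

(** Testing with a solution ls 0 of the adjoint equation such that ls 0 t = 0 and
    ls 1 t = - 1 leaves, on the left-hand side of the weak identity at time t,
    only the space integral of the solution: the terms with the time derivative
    and with b vanish at time t, and the double integral vanishes by the choice
    of ls.  The result is a Duhamel formula for the space integral, obtained
    without any differentiation in time. *)
Lemma weak_duhamel : exists phi : R -> space -> R,
  [/\ forall s, continuous (phi s),
      forall s x, s <= t -> 0 <= phi s x,
      forall s x, 0 <= s -> s <= t -> eball rho x -> phi s x = ls 0 s &
      (\int[leb R n]_x (u t x)%:E =
        eps%:E * ((ls 0 0)%:E * \int[leb R n]_x (u1 x)%:E) +
        eps%:E * ((b * ls 0 0 - ls 1 0)%:E * \int[leb R n]_x (u0 x)%:E) +
        \int[@lebesgue_measure R]_(s in `[0%R, t])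
          ((Gamma s)%:E * Lp_mass p (u s) `^ beta
           * \int[leb R n]_x (`|u s x| `^ p * phi s x)%:E))%E].
Proof.
have [t2 tt2 t2T] := lte_between tT.
(* The cutoff in time equals 1 up to t1 > t and vanishes after t2 < T. *)
pose t1 := (t + t2) / 2.
have tt1 : t < t1 by rewrite /t1; lra.
have t12 : t1 < t2 by rewrite /t1; lra.
have t10 : 0 < t1 by exact: lt_trans tt1.
have rho1 : 0 < rho + 1 by rewrite addr_gt0.
pose f := product_test (n := n) ls t1 t2 (rho + 1).
have plat s x : 0 <= s -> s <= t -> eball rho x -> plateau t1 (rho + 1) (s, x).
  move=> s0 st /eball_sqnorm hx; split => /=.
    by rewrite ltrXn2r ?nnegrE// ?(ltW t10)// (le_lt_trans st).
  apply: le_lt_trans (hx (ltW rho_gt0)) _.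
  by rewrite ltrXn2r ?nnegrE ?(ltW rho_gt0) ?(ltW rho1)// ltrDl.
have eb_r : (eball r : set space) `<=` eball rho.
  by apply: subset_eball; rewrite lerDl ltW// divr_gt0.
have ef : elementary f by exact: elementary_product_test.
have edf : elementary (dt f) by exact: elementary_D.
have eddf : elementary (dt (dt f)) by exact: elementary_D.
have elf : elementary (laplacian f).
  by apply: elementary_sum => i; do 2 apply: elementary_D.
exists (fun s x => f (s, x)); split.
- by move=> s; exact: elementary_slice_continuous.
- by move=> s x st; rewrite mulr_ge0 ?ls_ge0// bump_ge0.
- by move=> s x s0 st ex; rewrite /f product_test_plateau//; exact: plat.
have [ut _ [_ _ /(_ t f t0 tT)]] := wu.
move=> /(_ (product_test_function dls t10 t12 rho1 t2T)).
rewrite /weak_identity.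
have e0 (v : space -> R) : (\int[leb R n]_x (v x * f (t, x))%:E = 0)%E.
  under eq_integral do rewrite /f /product_test/= lst mul0r mulr0.
  exact: integral0.
rewrite [X in (X - _ + _ + _ = _)%E]e0 [X in (_ + b%:E * X + _ = _)%E]e0.
rewrite mule0 adde0 add0e.
rewrite (integral_mul_cst (S := eball rho) (a := -1)); last first.
- by move=> x ex; rewrite dt_product_test//= ?lst1//; apply: plat => //; exact: ltW.
- exact: solution_vanishes.
- exact: elementary_slice_continuous.
- exact: solution_integrable.
rewrite EFinN mulN1e oppeK integral_singleton ?adde0; last 2 first.
- exact: ltW.
- move=> s s0 st.
  have sT : (s%:E < T)%E by apply: le_lt_trans tT; rewrite lee_fin.
  rewrite (integral_mul_cst (S := eball rho) (a := 0)) ?mul0e//.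
  + exact: solution_integrable.
  + set K := c ^+ 2 * _.
    apply: (elementary_slice_continuous (f := fun z =>
      dt (dt f) z - K * laplacian f z - b * dt f z + m2 * f z)).
    under eq_fun do rewrite -!mulNr.
    by do 3 ?[apply: elementary_add]; rewrite //;
      apply: elementary_mul => //; exact: elementary_cst.
  + exact: solution_vanishes.
  + move=> x ex; have px : plateau t1 (rho + 1) (s, x).
      by apply: plat => //; exact: ltW.
    rewrite dtt_product_test// laplacian_product_test// dt_product_test//.
    by rewrite /f product_test_plateau//= mulr0 subr0 ode.
move=> ->; congr (_ + _)%E; congr (_ + _)%E; congr (_ * _)%E.
- rewrite (integral_mul_cst (S := eball r) (a := ls 0 0))//.
    exact: elementary_slice_continuous.
  by move=> x /eb_r ex; rewrite /f product_test_plateau//; apply: plat => //; exact: ltW.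
- rewrite (integral_mul_cst (S := eball r) (a := b * ls 0 0 - ls 1 0))//.
    apply: (elementary_slice_continuous (f := fun z => b * f z - dt f z)).
    under eq_fun do rewrite -[- dt f _]mulN1r.
    by apply: elementary_add; apply: elementary_mul => //; exact: elementary_cst.
  move=> x /eb_r ex; have px : plateau t1 (rho + 1) (0, x).
    by apply: plat => //; exact: ltW.
  by rewrite /f product_test_plateau// dt_product_test.
Qed.

End duhamel.

(** * Integral inequality for the weighted space integral *)

(** For each final time t, ls is the jet of the solution of the adjoint equation
    to be used in the Duhamel formula.  It is written as the slow exponential
    with rate al times a kernel k, because the solution will be weighted by
    expR (al * t).  The last clause is the lower bound on the coefficient of the
    initial position. *)
Definition adjoint_kernel (R : realType) (b m2 al : R) (k : R -> R) : Prop :=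
  forall t : R, exists ls : nat -> R -> R,
    [/\ forall i (x : R), is_derive x 1 (ls i) (ls i.+1 x),
        forall s, ls 2 s - b * ls 1 s + m2 * ls 0 s = 0,
        ls 0 t = 0 /\ ls 1 t = -1,
        forall s, ls 0 s = expR (- (al * (t - s))) * k (t - s) &
        0 <= t -> expR (- (al * t)) <= b * ls 0 0 - ls 1 0].

Lemma is_derive_expR_affine (R : realType) (a t x : R) :
  is_derive x 1 (fun s => expR (- (a * (t - s)))) (a * expR (- (a * (t - x)))).
Proof.
have D : is_derive x (1 : R) (fun s : R => - (a * (t - s))) a.
  rewrite (_ : (fun s : R => _) = (fun s : R => s) * cst a + cst (- (a * t))).
    have := is_deriveD (is_deriveM (is_derive_id x (1:R))
      (is_derive_cst a x (1:R))) (is_derive_cst (- (a * t)) x (1:R)).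
    by rewrite /= scaler0 add0r addr0 [_ *: _]mulr1.
  by apply/funext => s; rewrite !fctE; ring.
by rewrite mulrC; apply: (is_derive_comp1 D (is_derive_expR _)).
Qed.

(** The adjoint solution is the difference quotient of the exponentials with the
    two rates a1 < a2. *)
Lemma distinct_roots_kernel (R : realType) (b m2 a1 a2 : R) :
  0 <= a1 -> a1 < a2 -> a1 + a2 = b -> a1 * a2 = m2 ->
  adjoint_kernel b m2 a1 (fun x => (1 - expR (- ((a2 - a1) * x))) / (a2 - a1)).
Proof.
move=> a10 a12 sb pm t; have d0 : a2 - a1 != 0 by rewrite gt_eqF// subr_gt0.
exists (fun i s => (a1 ^+ i * expR (- (a1 * (t - s)))
  - a2 ^+ i * expR (- (a2 * (t - s)))) / (a2 - a1)); split.
- move=> i x.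
  have D := is_deriveM (is_deriveB (is_deriveM (is_derive_cst (a1 ^+ i) x (1:R))
    (is_derive_expR_affine a1 t x)) (is_deriveM (is_derive_cst (a2 ^+ i) x (1:R))
    (is_derive_expR_affine a2 t x))) (is_derive_cst (a2 - a1)^-1 x (1:R)).
  apply: is_derive_eq D _.
  by rewrite !fctE !scaler0 !addr0 add0r /GRing.scale/= !exprSr; ring.
- by move=> s; rewrite -sb -pm expr0 expr1; ring.
- by rewrite subrr !mulr0 oppr0 expR0; split; field.
- move=> s; rewrite !expr0 !mul1r mulrA; congr (_ / _).
  by rewrite [RHS]mulrBr mulr1 -expRD; congr (_ - expR _); ring.
- move=> t0; rewrite !expr0 !expr1 !mul1r subr0 -sb.
  set e1 := expR (- (a1 * t)); set e2 := expR (- (a2 * t)).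
  have e21 : e2 <= e1 by rewrite ler_expR lerN2 ler_wpM2r// ltW.
  rewrite -subr_ge0 [X in 0 <= X](_ : _ = a1 * (e1 - e2) / (a2 - a1)).
    by rewrite divr_ge0 ?mulr_ge0 ?subr_ge0// ltW.
  by field.
Qed.

(** The limiting case of equal rates, with adjoint solution
    (t - s) expR (- (a * (t - s))).  The i-th derivative has a factor a ^+ i.-1,
    whose coefficient i%:R makes it vanish for i = 0. *)
Lemma double_root_kernel (R : realType) (b m2 a : R) : 0 <= a ->
  a + a = b -> a * a = m2 -> adjoint_kernel b m2 a id.
Proof.
move=> a0 sb pm t.
exists (fun i s => (a ^+ i * (t - s) - i%:R * a ^+ i.-1) * expR (- (a * (t - s)))).
split.
- move=> i x.
  have D := is_deriveM (is_deriveB (is_deriveM (is_derive_cst (a ^+ i) x (1:R))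
    (is_deriveB (is_derive_cst t x (1:R)) (is_derive_id x (1:R))))
    (is_derive_cst (i%:R * a ^+ i.-1) x (1:R))) (is_derive_expR_affine a t x).
  apply: is_derive_eq D _.
  rewrite !fctE !scaler0 !subr0 sub0r addr0 /GRing.scale/=.
  case: i => [|i]; first by rewrite !expr0 !expr1; ring.
  by rewrite /= !exprS -!natr1; ring.
- by move=> s; rewrite -sb -pm /= expr0 ?expr1; ring.
- by rewrite subrr !mulr0 oppr0 expR0 /= expr0 ?expr1; split; ring.
- by move=> s; rewrite /= expr0; ring.
- move=> t0; rewrite /= !expr0 ?expr1 subr0 -sb.
  set e := expR _; have e0 : 0 <= e by exact: expR_ge0.
  rewrite -subr_ge0 [X in 0 <= X](_ : _ = a * t * e); last by ring.
  by rewrite !mulr_ge0.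
Qed.

Section growth.
Context {R : realType} {n : nat}.
Local Notation space := 'rV[R]_n.
Variables (c H b m2 beta p kappa mu r al : R) (k : R -> R).
Variables (u0 u1 : space -> R).
Hypotheses (c0 : 0 < c) (H0 : 0 < H) (r0 : 0 < r).
Hypotheses (beta0 : 0 <= beta) (p1 : 1 < p) (mu0 : 0 < mu).
Hypothesis ral : r_crit b m2 beta p = al * ((beta + 1) * p - 1).
Hypothesis ker : adjoint_kernel b m2 al k.
Hypothesis k_ge0 : forall x, 0 <= x -> 0 <= k x.
Hypothesis k_le : forall x y, 0 <= x -> x <= y -> k x <= k y.
Hypothesis I0 : (leb R n).-integrable setT (EFin \o u0).
Hypothesis I1 : (leb R n).-integrable setT (EFin \o u1).
Hypothesis u00 : {ae leb R n, forall x, ~ eball r x -> u0 x = 0}.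
Hypothesis u10 : {ae leb R n, forall x, ~ eball r x -> u1 x = 0}.

Definition total_mass (v : space -> R) : R := fine (\int[leb R n]_x (v x)%:E).

Lemma total_massE (v : space -> R) : (leb R n).-integrable setT (EFin \o v) ->
  (\int[leb R n]_x (v x)%:E)%E = (total_mass v)%:E.
Proof. by move=> Iv; rewrite fineK//; exact: integrable_fin_num. Qed.

Hypothesis m0 : 0 <= total_mass u0.
Hypothesis m1 : 0 <= total_mass u1.

Let q := (beta + 1) * p.
Let rho := r + c / H.
Let growth_cst := mu * @jensen_cst R n p rho `^ (beta + 1).

Variables (eps : R) (T : \bar R) (u : R -> space -> R).
Hypothesis eps0 : 0 < eps.
Hypothesis wu : weak_solution c H b m2 beta p (Gamma_crit b m2 beta p mu kappa)
  eps r u0 u1 T u.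

(** The factor expR (al * t) compensates the slowest decay of the linear
    equation. *)
Definition weighted_mass (t : R) : R := expR (al * t) * total_mass (u t).

Let Gam_ge0 s : 0 <= Gamma_crit b m2 beta p mu kappa s.
Proof. by rewrite /Gamma_crit !mulr_ge0 ?expR_ge0 ?powR_ge0// ltW. Qed.

(** The common source of the two bounds below: the source term of the Duhamel
    formula is discarded outside A, with A empty for the first bound and an
    interval on which the mass is already large for the second. *)
Let duhamel_ineq t (a : R) (A : set R) (mA : R) : 0 < t -> (t%:E < T)%E ->
  measurable A -> A `<=` `[0, t]%classic -> 0 <= a ->
  @lebesgue_measure R A = mA%:E ->
  (forall s (g : space -> R), A s -> continuous g -> (forall x, 0 <= g x) ->
    (forall x, eball rho x -> g x = expR (- (al * (t - s))) * k (t - s)) ->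
    (a%:E <= (Gamma_crit b m2 beta p mu kappa s)%:E * Lp_mass p (u s) `^ beta
           * \int[leb R n]_x (`|u s x| `^ p * g x)%:E)%E) ->
  eps * (total_mass u0 + total_mass u1 * k t) + expR (al * t) * (a * mA)
    <= weighted_mass t.
Proof.
move=> t0 tT mmA At a0 Am ha.
have [ls [dls ode [lst lst1] lsE ls0]] := ker t.
have ls_ge0 s : s <= t -> 0 <= ls 0 s.
  by move=> st; rewrite lsE mulr_ge0 ?expR_ge0// k_ge0// subr_ge0.
have [phi [cphi phi0 phi1]] :=
  weak_duhamel c0 H0 r0 wu dls ode lst lst1 ls_ge0 t0 tT I0 I1 u00 u10.
have Iu := solution_integrable c0 H0 wu t0 tT.
rewrite !total_massE//.
set J := (\int[_]_(s in _) _)%E => UJ.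
have aJ : ((a * mA)%:E <= J)%E.
  rewrite EFinM -Am; apply: ge0_le_integral_cst => //.
    move=> s /=; rewrite in_itv/= => /andP[s0 st].
    rewrite !mule_ge0 ?lee_fin ?poweR_ge0//; apply: integral_ge0 => x _.
    by rewrite lee_fin mulr_ge0 ?powR_ge0// phi0.
  move=> s As; have := At _ As; rewrite /= in_itv/= => /andP[s0 st].
  apply: ha => // [x|x ex]; first exact: phi0.
  by rewrite phi1// lsE.
have := leeD2l (eps%:E * ((ls 0 0)%:E * (total_mass u1)%:E) +
  eps%:E * ((b * ls 0 0 - ls 1 0)%:E * (total_mass u0)%:E))%E aJ.
rewrite -UJ -!EFinM -!EFinD lee_fin => h.
rewrite /weighted_mass.
apply: (@le_trans _ _ (expR (al * t) * (eps * (ls 0 0 * total_mass u1) +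
  eps * ((b * ls 0 0 - ls 1 0) * total_mass u0) + a * mA))); last first.
  by rewrite ler_wpM2l// expR_ge0.
have EE : expR (al * t) * expR (- (al * t)) = 1 by rewrite -expRD subrr expR0.
set D := b * ls 0 0 - ls 1 0 in ls0 *.
have D1 : 1 <= expR (al * t) * D.
  by rewrite -EE ler_wpM2l ?expR_ge0// ls0// ltW.
have -> : expR (al * t) * (eps * (ls 0 0 * total_mass u1) +
    eps * (D * total_mass u0) + a * mA) = eps * ((expR (al * t) * ls 0 0) *
    total_mass u1 + (expR (al * t) * D) * total_mass u0) +
    expR (al * t) * (a * mA) by ring.
rewrite lerD2r ler_wpM2l ?(ltW eps0)// [ls 0 0]lsE subr0 [expR _ * (_ * _)]mulrA EE mul1r.
rewrite addrC [k t * _]mulrC lerD2l.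
by rewrite ler_peMl.
Qed.

(** The contribution of the data alone: the source term is nonnegative. *)
Lemma weighted_mass_base t : 0 < t -> (t%:E < T)%E ->
  eps * (total_mass u0 + total_mass u1 * k t) <= weighted_mass t.
Proof.
move=> t0 tT.
have := @duhamel_ineq t 0 set0 0 t0 tT measurable0 (@sub0set _ _) (lexx _).
by rewrite mul0r mulr0 addr0; apply => //; rewrite measure0.
Qed.

(** A lower bound M on [t0, t] improves itself: only the source term on
    [t0, t0 + h / 2] is kept, where the kernel is at least k (h / 2).  The
    exponent r_crit is exactly what makes the exponential factors of Gamma, of
    the adjoint solution and of the weight cancel. *)
Lemma weighted_mass_step t0 h t M g : 0 < t0 -> 0 < h -> t0 + h <= t ->
  (t%:E < T)%E -> 0 < M -> (forall s, t0 <= s -> s <= t -> M <= weighted_mass s) ->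
  0 <= g -> (forall s, t0 <= s -> s <= t0 + h / 2 -> g <= (1 + s) `^ kappa) ->
  growth_cst * g * k (h / 2) * (h / 2) * M `^ q <= weighted_mass t.
Proof.
move=> t00 h0 ht tT M0 MV g0 hg.
have rho0 : 0 < rho by rewrite addr_gt0// divr_gt0.
have C0 : 0 < growth_cst.
  by rewrite mulr_gt0// powR_gt0// jensen_cst_gt0.
have t_gt0 : 0 < t by lra.
have kh0 : 0 <= k (h / 2) by rewrite k_ge0// divr_ge0// ltW.
pose a := expR (- (al * t)) * (growth_cst * g * k (h / 2) * M `^ q).
have a0 : 0 <= a.
  by rewrite !mulr_ge0 ?expR_ge0 ?powR_ge0// ltW.
have EE : expR (al * t) * expR (- (al * t)) = 1 by rewrite -expRD subrr expR0.
have := @duhamel_ineq t a `[t0, t0 + h / 2]%classic (h / 2) t_gt0 tT _ _ a0 _ _.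
set X := eps * _ => ineq.
have X0 : 0 <= X.
  by rewrite mulr_ge0 ?(ltW eps0)// addr_ge0// mulr_ge0// k_ge0// ltW.
have <- : expR (al * t) * (a * (h / 2)) =
    growth_cst * g * k (h / 2) * (h / 2) * M `^ q.
  transitivity ((expR (al * t) * expR (- (al * t))) *
    (growth_cst * g * k (h / 2) * (h / 2) * M `^ q)); first by rewrite /a; ring.
  by rewrite EE mul1r.
apply: le_trans (ineq _ _ _ _).
- by rewrite lerDr.
- exact: measurable_itv.
- by move=> s /=; rewrite !in_itv/= => /andP[s1 s2]; apply/andP; split; lra.
- rewrite lebesgue_measure_itv/= lte_fin ifT; last by lra.
  by rewrite -EFinB; congr EFin; ring.
move=> s f /=; rewrite in_itv/= => /andP[s1 s2] cf f0 fE.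
have s_gt0 : 0 < s by lra.
have sT : (s%:E < T)%E by apply: le_lt_trans tT; rewrite lee_fin; lra.
have Iu := solution_integrable c0 H0 wu s_gt0 sT.
have vu := solution_vanishes c0 H0 wu s_gt0 sT.
pose w := M * expR (- (al * s)).
have w0 : 0 < w by rewrite mulr_gt0// expR_gt0.
have wU : (w%:E <= \int[leb R n]_x (u s x)%:E)%E.
  rewrite total_massE// lee_fin /w expRN ler_pdivrMr ?expR_gt0// mulrC.
  by apply: MV => //; lra.
have kt0 : 0 <= k (t - s) by rewrite k_ge0// subr_ge0; lra.
have lam0 : 0 <= expR (- (al * (t - s))) * k (t - s) by rewrite mulr_ge0// expR_ge0.
apply: le_trans (nonlinear_term_ge p1 beta0 rho0 w0 (Gam_ge0 s) lam0 Iu vu wU cf f0 fE).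
rewrite lee_fin /a.
have -> : (@jensen_cst R n p rho * w `^ p) `^ (beta + 1) =
    @jensen_cst R n p rho `^ (beta + 1) * (M `^ q * expR (- (al * s * q))).
  rewrite powRM ?powR_ge0 ?(ltW (jensen_cst_gt0 _ rho0))//; congr (_ * _).
  rewrite -powRrM mulrC -/q /w powRM ?expR_ge0 ?(ltW M0)//.
  by rewrite -expRM mulNr.
rewrite /Gamma_crit ral -/q.
set Y := jensen_cst _ _ `^ _.
have E1 : expR (al * (q - 1) * s) * expR (- (al * (t - s))) * expR (- (al * s * q))
    = expR (- (al * t)).
  by rewrite -!expRD; congr expR; ring.
have -> : mu * expR (al * (q - 1) * s) * (1 + s) `^ kappa *
    (expR (- (al * (t - s))) * k (t - s)) * (Y * (M `^ q * expR (- (al * s * q))))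
  = expR (- (al * t)) * (growth_cst * (1 + s) `^ kappa * k (t - s) * M `^ q).
  by rewrite -E1 /growth_cst -/Y; ring.
rewrite ler_wpM2l ?expR_ge0// ler_wpM2r ?powR_ge0//.
apply: ler_pM => //.
- by rewrite mulr_ge0// ltW.
- by rewrite ler_wpM2l ?(ltW C0)// hg.
- by apply: k_le; lra.
Qed.

End growth.

(** * Blow-up by doubling *)

Lemma doubling_ratio_lt1 (R : realType) (q : R) : 1 < q ->
  2 `^ (- ((q - 1) / 2)) < 1.
Proof.
move=> q1; rewrite powRN invf_lt1 ?powR_gt0//.
have e0 : 0 < (q - 1) / 2 by lra.
have := gt0_ltr_powR e0 (x := 1) (y := 2).
by rewrite powR1 !nnegrE ltr1n; apply.
Qed.

(** The times t_j = L (2 - rho^j) increase to 2 L, and the value of V doubles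
    from each one to the next: over the step h = L (1 - rho) rho^j the gain is
    proportional to rho^(2 j) 2^(q j), and rho is chosen so that
    rho^2 2^(q - 1) = 1, which makes the gain exactly comparable to 2^j.  If
    T were larger than 2 L, the finite number V (2 L) would be at least
    2^j M0 for every j. *)
Lemma doubling_blowup (R : realType) (V : R -> R) (T : \bar R) (L q M0 B : R) :
  0 < L -> 1 < q -> 0 < M0 ->
  (forall t, L <= t -> (t%:E < T)%E -> M0 <= V t) ->
  (forall t0 h t M, L <= t0 -> 0 < h -> t0 + h <= t -> t <= 2 * L ->
     (t%:E < T)%E -> 0 < M -> (forall s, t0 <= s -> s <= t -> M <= V s) ->
     B * (h / L) ^+ 2 * M `^ q <= V t) ->
  2 <= B * (1 - 2 `^ (- ((q - 1) / 2))) ^+ 2 * M0 `^ (q - 1) ->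
  (T <= (2 * L)%:E)%E.
Proof.
move=> L0 q1 M00 base step BM; rewrite leNgt; apply/negP => LT.
set rho : R := 2 `^ (- ((q - 1) / 2)) in BM.
have rho0 : 0 < rho by rewrite powR_gt0.
have rho1 : rho < 1 by exact: doubling_ratio_lt1.
have rho2 : rho ^+ 2 * 2 `^ (q - 1) = 1.
  rewrite -powR_mulrn ?ltW// /rho -powRrM -powRD; last by apply/implyP.
  by rewrite (_ : _ + _ = 0) ?powRr0//; lra.
have B0 : 0 < B.
  have : 0 < B * (1 - rho) ^+ 2 * M0 `^ (q - 1) by lra.
  rewrite -mulrA pmulr_lgt0// mulr_gt0 ?powR_gt0 ?exprn_gt0//; lra.
pose tj (j : nat) := L * (2 - rho ^+ j).
have tj_le j : tj j <= 2 * L.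
  rewrite /tj mulrC ler_wpM2r ?(ltW L0)//.
  by rewrite lerBlDr lerDl exprn_ge0// ltW.
have tj_ge j : L <= tj j.
  rewrite /tj ler_peMr ?(ltW L0)//.
  have : rho ^+ j <= 1 by rewrite exprn_ile1// ltW.
  lra.
have tjS j : tj j.+1 = tj j + L * (rho ^+ j * (1 - rho)).
  by rewrite /tj exprS; ring.
have key j t : tj j <= t -> t <= 2 * L -> 2 ^+ j * M0 <= V t.
  elim: j t => [|j IH] t ht tL.
    rewrite expr0 mul1r; apply: base.
      exact: le_trans (tj_ge 0%N) ht.
    by apply: le_lt_trans LT; rewrite lee_fin.
  set h := L * (rho ^+ j * (1 - rho)).
  have h0 : 0 < h by rewrite !mulr_gt0 ?exprn_gt0//; lra.
  apply: le_trans (step (tj j) h t (2 ^+ j * M0) (tj_ge j) h0 _ tL _ _ _).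
  - rewrite (_ : h / L = rho ^+ j * (1 - rho)); last first.
      by rewrite /h mulrC mulKf// gt_eqF.
    set X := 2 ^+ j * M0.
    have X0 : 0 < X by rewrite mulr_gt0 ?exprn_gt0.
    have -> : X `^ q = X * X `^ (q - 1).
      by rewrite -{2}(powRr1 (ltW X0)) -powRD ?(gt_eqF X0) ?implybT//;
        congr (_ `^ _); ring.
    have -> : X `^ (q - 1) = (2 `^ (q - 1)) ^+ j * M0 `^ (q - 1).
      rewrite powRM ?exprn_ge0// ?(ltW M00)//; congr (_ * _).
      by rewrite -[2 ^+ j]powR_mulrn// -[RHS]powR_mulrn ?powR_ge0// -!powRrM mulrC.
    set P := M0 `^ (q - 1) in BM *.
    have -> : B * (rho ^+ j * (1 - rho)) ^+ 2 * (X * ((2 `^ (q - 1)) ^+ j * P))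
      = (rho ^+ 2 * 2 `^ (q - 1)) ^+ j * (B * (1 - rho) ^+ 2 * P) * X.
      rewrite [in RHS]exprMn -exprM mulnC exprM.
      by set Y := _ ^+ j; set Z := (2 `^ (q - 1)) ^+ j; ring.
    rewrite rho2 expr1n mul1r exprS -/X -mulrA -/X ler_wpM2r//.
    exact: ltW.
  - by rewrite -tjS.
  - by apply: le_lt_trans LT; rewrite lee_fin.
  - by rewrite mulr_gt0 ?exprn_gt0.
  - by move=> s s1 s2; apply: IH => //; apply: le_trans tL.
have V0 j : 2 ^+ j * M0 <= V (2 * L) by apply: key.
have [N hN] : exists N : nat, V (2 * L) / M0 < N%:R.
  exists (Num.bound (V (2 * L) / M0)); apply: archi_boundP.
  rewrite divr_ge0 ?(ltW M00)// (le_trans _ (V0 0%N))//.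
  by rewrite expr0 mul1r ltW.
have := V0 N; rewrite leNgt -ltr_pdivrMr// => /negP; apply.
apply: lt_le_trans hN _.
by rewrite -natrX ler_nat ltnW// ltn_expl.
Qed.

(** The length L at which A L^N eps^(q - 1) is of order one; the factor D only
    absorbs the constants, and D >= 1 keeps L >= 1 when eps <= 1. *)
Lemma choose_scale (R : realType) (N q A : R) : 0 < N -> 1 < q -> 0 < A ->
  exists2 D : R, 1 <= D & forall eps : R, 0 < eps -> eps <= 1 ->
    let L := D * eps `^ (- ((q - 1) / N)) in
    1 <= L /\ 2 <= A * L `^ N * eps `^ (q - 1).
Proof.
move=> N0 q1 A0; pose D := Num.max 1 ((2 / A) `^ N^-1).
have D1 : 1 <= D by rewrite le_max lexx.
exists D => // eps e0 e1 L.
have D0 : 0 < D by exact: lt_le_trans D1.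
split.
  rewrite /L -[leLHS]mulr1 ler_pM//.
  rewrite powRN -[leLHS]invr1 lef_pV2 ?posrE ?powR_gt0//.
  rewrite -[leRHS](powRr0 eps) ger_powR ?e0//=.
  by rewrite divr_ge0 ?(ltW N0)// subr_ge0 ltW.
have -> : L `^ N = D `^ N * eps `^ (- (q - 1)).
  rewrite /L powRM ?powR_ge0 ?(ltW D0)// -powRrM; congr (_ * _ `^ _).
  by field; rewrite gt_eqF.
rewrite -!mulrA -powRD ?(gt_eqF e0) ?implybT// addNr powRr0 mulr1.
rewrite mulrC -ler_pdivrMr//.
rewrite -[leLHS](_ : ((2 / A) `^ N^-1) `^ N = _).
  by apply: ge0_ler_powR; rewrite ?nnegrE ?powR_ge0 ?(ltW N0) ?(ltW D0)// le_max lexx orbT.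
by rewrite -powRrM mulVf ?gt_eqF// powRr1// divr_ge0// ltW.
Qed.

(** * Lifespan *)

Lemma effective_power_gt1 (R : realType) (beta p : R) :
  0 <= beta -> 1 < p -> 1 < (beta + 1) * p.
Proof.
move=> beta0 p1; apply: (lt_le_trans p1).
by rewrite mulrDl mul1r lerDr mulr_ge0// ltW// (lt_trans ltr01).
Qed.

(** On [L, 2 L] the ratio (1 + s) / L lies in [1, 3], whatever the sign of
    kappa. *)
Lemma powR_dyadic_ge (R : realType) (kappa L s : R) :
  1 <= L -> L <= s -> s <= 2 * L ->
  3 `^ (- `|kappa|) * L `^ kappa <= (1 + s) `^ kappa.
Proof.
move=> L1 Ls s2; have L0 : 0 < L by lra.
have -> : 1 + s = (1 + s) / L * L by rewrite divfK// gt_eqF.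
set x := (1 + s) / L.
have x1 : 1 <= x by rewrite ler_pdivlMr// mul1r; lra.
have x3 : x <= 3 by rewrite ler_pdivrMr//; lra.
have x0 : 0 < x by lra.
rewrite [leRHS]powRM ?(ltW x0) ?(ltW L0)// ler_wpM2r ?powR_ge0//.
have [k0|k0] := leP 0 kappa.
  rewrite ger0_norm// powRN (@le_trans _ _ 1)//.
    by rewrite invf_le1 ?powR_gt0// -[leLHS](powRr0 3) ler_powR//; lra.
  by rewrite -[leLHS](powRr0 x) ler_powR.
rewrite ltr0_norm// opprK -[kappa]opprK.
have e0 : 0 <= - kappa by rewrite oppr_ge0 ltW.
move: (- kappa) e0 => e e0.
rewrite !powRN lef_pV2 ?posrE ?powR_gt0//.
by apply: ge0_ler_powR; rewrite ?nnegrE; lra.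
Qed.

Section lifespan.
Context {R : realType} {n : nat}.
Local Notation space := 'rV[R]_n.
Variables (c H b m2 beta p kappa mu r al : R) (k : R -> R).
Variables (u0 u1 : space -> R).
Hypotheses (c0 : 0 < c) (H0 : 0 < H) (r0 : 0 < r).
Hypotheses (beta0 : 0 <= beta) (p1 : 1 < p) (mu0 : 0 < mu).
Hypothesis ral : r_crit b m2 beta p = al * ((beta + 1) * p - 1).
Hypothesis ker : adjoint_kernel b m2 al k.
Hypothesis k_ge0 : forall x, 0 <= x -> 0 <= k x.
Hypothesis k_le : forall x y, 0 <= x -> x <= y -> k x <= k y.
Hypothesis I0 : (leb R n).-integrable setT (EFin \o u0).
Hypothesis I1 : (leb R n).-integrable setT (EFin \o u1).
Hypothesis u00 : {ae leb R n, forall x, ~ eball r x -> u0 x = 0}.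
Hypothesis u10 : {ae leb R n, forall x, ~ eball r x -> u1 x = 0}.
Hypothesis m0 : 0 <= total_mass u0.
Hypothesis m1 : 0 <= total_mass u1.

Let q := (beta + 1) * p.

(** Here L is the time scale: nu measures the growth of the kernel
    (k x >= k0 L^(nu - 2) x for x <= L) and om that of the linear part of the
    solution (at least eps mm L^om after time L).  Balancing the gain
    L^(kappa + nu) M^q against M for M = eps mm L^om gives the exponent. *)
Lemma lifespan_of_kernel (nu om k0 mm : R) : 0 < k0 -> 0 < mm ->
  (forall L x : R, 1 <= L -> 0 < x -> x <= L -> k0 * L `^ (nu - 2) * x <= k x) ->
  (forall L t : R, 1 <= L -> L <= t ->
     mm * L `^ om <= total_mass u0 + total_mass u1 * k t) ->
  0 < kappa + nu + om * (q - 1) ->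
  exists2 C, 0 < C & forall (eps : R) (T : \bar R) (u : R -> space -> R),
    0 < eps -> eps <= 1 ->
    weak_solution c H b m2 beta p (Gamma_crit b m2 beta p mu kappa)
      eps r u0 u1 T u ->
    (T <= (C * eps `^ (- ((q - 1) / (kappa + nu + om * (q - 1)))))%:E)%E.
Proof.
move=> k00 mm0 hk hm; set N := kappa + nu + om * (q - 1) => N0.
have q1 : 1 < q by exact: effective_power_gt1.
have rho0 : 0 < r + c / H by rewrite addr_gt0// divr_gt0.
pose G := mu * @jensen_cst R n p (r + c / H) `^ (beta + 1).
have G0 : 0 < G by rewrite mulr_gt0// powR_gt0// jensen_cst_gt0.
pose g3 : R := 3 `^ (- `|kappa|).
have g30 : 0 < g3 by rewrite powR_gt0.
pose z : R := 1 - 2 `^ (- ((q - 1) / 2)).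
pose B0 := G * g3 * k0 / 4.
have B00 : 0 < B0.
  by rewrite divr_gt0//; apply: mulr_gt0 => //; exact: mulr_gt0.
have z0 : 0 < z by rewrite subr_gt0 doubling_ratio_lt1.
have A0 : 0 < B0 * z ^+ 2 * mm `^ (q - 1).
  by apply: mulr_gt0; [apply: mulr_gt0; rewrite ?exprn_gt0|exact: powR_gt0].
have [D D1 hD] := choose_scale N0 q1 A0.
exists (2 * D) => [|eps T u e0 e1 wu]; first by lra.
have {hD} /= := hD eps e0 e1; set L := D * _ => -[L1 hL].
have L0 : 0 < L by lra.
rewrite -mulrA -/L.
apply: (@doubling_blowup _ (weighted_mass al u) T L q (eps * (mm * L `^ om))
  (B0 * L `^ (kappa + nu))) => //.
- by rewrite !mulr_gt0// powR_gt0.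
- move=> t Lt tT.
  apply: le_trans (weighted_mass_base c0 H0 r0 mu0 ker k_ge0 I0 I1 u00 u10
    m0 e0 wu _ tT); last by lra.
  by rewrite ler_wpM2l ?(ltW e0)// hm.
- move=> t0 h t M Lt0 h0 ht t2 tT M0 MV.
  have hL2 : h / 2 <= L by lra.
  have h20 : 0 < h / 2 by lra.
  apply: le_trans (weighted_mass_step (g := g3 * L `^ kappa) c0 H0 r0 beta0 p1 mu0
    ral ker k_ge0 k_le I0 I1 u00 u10 m0 m1 e0 wu _ h0 ht tT M0 MV _ _).
  + rewrite -/q -/G ler_wpM2r ?powR_ge0//.
    apply: (@le_trans _ _ (G * (g3 * L `^ kappa) *
      (k0 * L `^ (nu - 2) * (h / 2)) * (h / 2))).
      have -> : L `^ (kappa + nu) = L `^ kappa * L `^ (nu - 2) * L ^+ 2.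
        rewrite -powR_mulrn ?(ltW L0)// -!powRD ?(gt_eqF L0) ?implybT//.
        by congr (_ `^ _); ring.
      rewrite le_eqVlt; apply/orP; left; apply/eqP.
      by rewrite /B0; field; rewrite gt_eqF.
    rewrite ler_wpM2r ?(ltW h20)// ler_wpM2l ?hk//.
    apply: mulr_ge0; first exact: ltW.
    by rewrite mulr_ge0 ?powR_ge0.
  + by lra.
  + by rewrite mulr_ge0 ?powR_ge0.
  + by move=> s s1 s2; apply: powR_dyadic_ge => //; lra.
rewrite -/z.
apply: le_trans hL _; rewrite le_eqVlt; apply/orP; left; apply/eqP.
clearbody L; rewrite [(eps * _) `^ _]powRM ?mulr_ge0 ?powR_ge0 ?(ltW e0) ?(ltW mm0)//.
rewrite [(mm * _) `^ _]powRM ?powR_ge0 ?(ltW mm0)// -powRrM.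
have -> : L `^ N = L `^ (kappa + nu) * L `^ (om * (q - 1)).
  by rewrite -powRD// (gt_eqF L0) implybT.
ring.
Qed.

End lifespan.

Lemma total_mass_gt0 (R : realType) (n : nat) (v : 'rV[R]_n -> R) :
  (leb R n).-integrable setT (EFin \o v) ->
  {ae leb R n, forall x, 0 <= v x} -> ~ {ae leb R n, forall x, v x = 0} ->
  0 < total_mass v.
Proof.
move=> Iv v0 vn0.
have mv : measurable_fun setT v.
  by have /measurable_int/measurable_EFinP := Iv.
have E : (\int[leb R n]_x (v x)%:E = \int[leb R n]_x `|(v x)%:E|)%E.
  apply: ae_eq_integral => //.
  - exact/measurable_EFinP.
  - by apply: measurableT_comp => //; exact/measurable_EFinP.
  - by apply: filterS v0 => x vx _; rewrite gee0_abs.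
rewrite -lte_fin -total_massE// E lt_neqAle integral_ge0// andbT eq_sym.
apply/eqP => /(ae_eq_integral_abs _ _ _).1 h; apply: vn0.
have := h measurableT _; move/measurable_EFinP: mv => mv /(_ mv).
by apply: filterS => x /(_ I) [].
Qed.

Unset Implicit Arguments.

Theorem theorem1p3 (R : realType) (n : nat)
    (c H b m2 beta p kappa mu r : R) (u0 u1 : 'rV[R]_n -> R) :
  (1 <= n)%N -> 0 < c -> 0 < H -> 0 <= b -> 0 <= m2 -> 4 * m2 <= b ^+ 2 ->
  0 <= beta -> 1 < p -> kappa_crit b m2 beta p < kappa -> 0 < mu -> 0 < r ->
  L1loc u0 -> L1loc u1 ->
  {ae leb R n, forall x, 0 <= u0 x} -> {ae leb R n, forall x, 0 <= u1 x} ->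
  ~ {ae leb R n, forall x, u0 x = 0} -> ~ {ae leb R n, forall x, u1 x = 0} ->
  compact (ess_supp u0) -> compact (ess_supp u1) ->
  ess_supp u0 `<=` eball r -> ess_supp u1 `<=` eball r ->
  exists eps0 C : R, [/\ 0 < eps0, 0 < C &
    forall (eps : R) (T : \bar R) (u : R -> 'rV[R]_n -> R),
      0 < eps -> eps <= eps0 -> (0 < T)%E ->
      has_lifespan c H b m2 beta p (Gamma_crit b m2 beta p mu kappa)
        eps r u0 u1 T u ->
      (T < +oo)%E /\
      (T <= (if 4 * m2 < b ^+ 2
             then C * eps `^ (- (((beta + 1) * p - 1) / (kappa + 1)))
             else C * eps `^ (- ((kappa + 2) / ((beta + 1) * p - 1) + 1)^-1))%:E)%E].
Proof.
move=> _ c0 H0 b0 m20 disc beta0 p1 kk mu0 r0 L0 L1 u0_ge0 u1_ge0 u0n u1n _ _ s0 s1.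
have van (v : 'rV[R]_n -> R) : ess_supp v `<=` eball r ->
    {ae leb R n, forall x, ~ eball r x -> v x = 0}.
  by move=> sv; apply: filterS (ess_supp_ae v) => x vx nx; apply: vx => /sv.
have {s0}u00 := van _ s0; have {s1}u10 := van _ s1.
have I0 := L1loc_integrable L0 u00; have I1 := L1loc_integrable L1 u10.
have M0 := total_mass_gt0 I0 u0_ge0 u0n; have M1 := total_mass_gt0 I1 u1_ge0 u1n.
set q := (beta + 1) * p in kk *.
have q1 : 1 < q by exact: effective_power_gt1.
suff [C C0 HC] : exists2 C, 0 < C & forall (eps : R) (T : \bar R)
    (u : R -> 'rV[R]_n -> R), 0 < eps -> eps <= 1 ->
    weak_solution c H b m2 beta p (Gamma_crit b m2 beta p mu kappa)
      eps r u0 u1 T u ->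
    (T <= (if 4 * m2 < b ^+ 2
           then C * eps `^ (- ((q - 1) / (kappa + 1)))
           else C * eps `^ (- ((kappa + 2) / (q - 1) + 1)^-1))%:E)%E.
  exists 1, C; split => // eps T u e0 e1 _ [wu _].
  have := HC eps T u e0 e1 wu; split => //.
  exact: le_lt_trans (HC eps T u e0 e1 wu) (ltry _).
set D := Num.sqrt (b ^+ 2 - 4 * m2).
have D2 : D ^+ 2 = b ^+ 2 - 4 * m2 by rewrite sqr_sqrtr// subr_ge0.
have Dge : 0 <= D by exact: sqrtr_ge0.
have Db : D <= b.
  by rewrite -(ler_pXn2r (n := 2)) ?nnegrE// D2 gerBl mulr_ge0.
pose a1 := 2^-1 * (b - D); pose a2 := 2^-1 * (b + D).
have a10 : 0 <= a1 by rewrite mulr_ge0// subr_ge0.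
have sb : a1 + a2 = b by rewrite /a1 /a2; field.
have pm : a1 * a2 = m2.
  have -> : a1 * a2 = (b ^+ 2 - D ^+ 2) / 4 by rewrite /a1 /a2; field.
  by rewrite D2; field.
have ral : r_crit b m2 beta p = a1 * ((beta + 1) * p - 1) by [].
move: kk; rewrite /kappa_crit -/q; case: ifPn => hdisc kk.
(* Distinct roots: nu = 1 and om = 0, since the kernel is bounded and the linear
   part of the weighted mass is at least eps times the mass of u0. *)
- have D0 : 0 < D by rewrite sqrtr_gt0 subr_gt0.
  have d0 : 0 < a2 - a1 by rewrite /a1 /a2; lra.
  have a12 : a1 < a2 by rewrite -subr_gt0.
  set d := a2 - a1 in d0.
  pose k x := (1 - expR (- (d * x))) / d.
  have ker : adjoint_kernel b m2 a1 k by exact: distinct_roots_kernel.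
  have k_le x y : 0 <= x -> x <= y -> k x <= k y.
    move=> x0 xy; rewrite /k ler_wpM2r ?invr_ge0 ?(ltW d0)// lerD2l lerN2.
    by rewrite ler_expR lerN2 ler_wpM2l// ltW.
  have k_ge0 x : 0 <= x -> 0 <= k x.
    by move=> x0; apply: le_trans (k_le 0 x (lexx _) x0); rewrite /k mulr0 oppr0 expR0 subrr mul0r.
  have [||||C C0 HC] := @lifespan_of_kernel R n c H b m2 beta p kappa mu r a1 k u0 u1
    c0 H0 r0 beta0 p1 mu0 ral ker k_ge0 k_le I0 I1 u00 u10 (ltW M0) (ltW M1)
    1 0 (1 + d)^-1 (total_mass u0) _ M0.
  + by rewrite invr_gt0; lra.
  (* Bounded kernel: k x >= x / (1 + d x) because expR y >= 1 + y. *)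
  + move=> L x L1' x0 xL.
    rewrite (_ : 1 - 2 = -1 :> R); last by ring.
    rewrite powR_inv1; last by lra.
    have dx : 0 < d * x by rewrite mulr_gt0.
    apply: (@le_trans _ _ (x / (1 + d * x))).
      rewrite mulrC ler_wpM2l ?(ltW x0)// -invfM lef_pV2 ?posrE ?mulr_gt0; try lra.
      have : d * x <= d * L by rewrite ler_wpM2l// ltW.
      nra.
    rewrite /k ler_pdivlMr// mulrAC ler_pdivrMr; last by lra.
    rewrite expRN.
    have := expR_ge1Dx (d * x); set E := expR _ => hE.
    have E0 : 0 < E by lra.
    have -> : 1 - E^-1 = (E - 1) / E by field; rewrite gt_eqF.
    rewrite mulrAC ler_pdivlMr//.
    nra.
  + by move=> L t L1' Lt; rewrite powRr0 mulr1 lerDl mulr_ge0 ?(ltW M1)// k_ge0//; lra.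
  + by rewrite mul0r addr0; lra.
  exists C => // eps T u e0 e1 wu.
  by have := HC eps T u e0 e1 wu; rewrite mul0r addr0.
(* Double root: nu = 2 and om = 1, since the kernel is the identity and the
   linear part grows at least like eps t times the mass of u1. *)
- have hD : b ^+ 2 - 4 * m2 = 0.
    by apply/eqP; rewrite subr_eq0 eq_le disc andbT leNgt.
  have D0 : D = 0 by rewrite /D hD sqrtr0.
  have a12 : a1 = a2 by rewrite /a1 /a2 D0; ring.
  have ker : adjoint_kernel b m2 a1 id.
    by apply: double_root_kernel; rewrite // {2}a12.
  have [|||C C0 HC] := @lifespan_of_kernel R n c H b m2 beta p kappa mu r a1 id u0 u1
    c0 H0 r0 beta0 p1 mu0 ral ker (fun x h => h) (fun x y _ h => h) I0 I1 u00 u10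
    (ltW M0) (ltW M1) 2 1 1 (total_mass u1) ltr01 M1.
  + by move=> L x L1' x0 xL; rewrite subrr powRr0 !mul1r.
  + move=> L t L1' Lt; rewrite powRr1; last by lra.
    by rewrite (@le_trans _ _ (total_mass u1 * t))// ?ler_wpM2l ?(ltW M1)// lerDr ltW.
  + by rewrite -/q; lra.
  exists C => // eps T u e0 e1 wu.
  have := HC eps T u e0 e1 wu; rewrite -/q.
  rewrite (_ : (q - 1) / (kappa + 2 + 1 * (q - 1)) = ((kappa + 2) / (q - 1) + 1)^-1)//.
  by field; apply/andP; split; rewrite gt_eqF//; lra.
Qed.
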